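(* For every integer $n\ge3$, there exists an algorithm to compute the list of all idoneal genera of rank $n$.
   Context: A lattice is a finitely generated free $\mathbb{Z}$-module $L$ with a nondegenerate symmetric bilinear pairing $b\colon L\times L\to\mathbb{Z}$. A genus is a complete set of isomorphism classes of lattices that are equivalent over $\mathbb{R}$ and over $\mathbb{Z}_p$ for each prime $p$ to a given lattice; as output of an algorithm, a genus can be represented for instance by its Conway–Sloane genus symbol. A positive definite genus $g$ is called idoneal if every lattice $L$ in $g$ contains an element $v$ with $b(v,v)=1$. *)

(* Defs.v *)
From HB Require Import structures.
From mathcomp Require Import all_boot all_order all_algebra.
From mathcomp Require Import boolp classical_sets reals.

Set Implicit Arguments.
Unset Strict Implicit.
Unset Printing Implicit Defensive.

Import Order.TTheory GRing.Theory Num.Theory.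

Local Open Scope ring_scope.

(** The ring of p-adic integers, as the inverse limit of the rings Z/p^k: a
    p-adic integer is a coherent family of canonical residues.  Coherence
    forces the k-th residue to lie in [0, p^k). *)

Section PadicInt.
Variable p : nat.

Local Notation q k := ((p ^ k)%N : int).

Record padic_int := PadicInt {
  padic_res : nat -> int;
  padic_coherent : forall k, padic_res k = (padic_res k.+1 %% q k)%Z }.

Lemma padic_intP x y : padic_res x =1 padic_res y -> x = y.
Proof.
case: x y => [x hx] [y hy] /= /funext xy; move: hx hy; rewrite xy => hx hy.
by congr PadicInt; exact: Prop_irrelevance.
Qed.

Lemma padic_res_mod x k : (padic_res x k %% q k)%Z = padic_res x k.
Proof. by rewrite padic_coherent modz_mod. Qed.

Lemma padic_mod_mod (a : int) k : ((a %% q k.+1)%Z %% q k)%Z = (a %% q k)%Z.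
Proof.
rewrite [in RHS](divz_eq a (q k.+1)).
have -> : ((a %/ q k.+1)%Z * q k.+1 = ((a %/ q k.+1)%Z * p%:Z) * q k)%R.
  by rewrite expnS PoszM mulrA.
by rewrite modzMDl.
Qed.

Lemma padic_of_coherent (f : nat -> int) :
  (forall k, (f k = f k.+1 %[mod q k])%Z) ->
  forall k, (f k %% q k)%Z = ((f k.+1 %% q k.+1)%Z %% q k)%Z.
Proof. by move=> fP k; rewrite padic_mod_mod fP. Qed.

Lemma padic_resS x k : (padic_res x k = padic_res x k.+1 %[mod q k])%Z.
Proof. by rewrite [in LHS]padic_coherent modz_mod. Qed.

Lemma padic_cst_subproof (a : int) k : (a = a %[mod q k])%Z.
Proof. by []. Qed.

Lemma padic_opp_subproof x k :
  (- padic_res x k = - padic_res x k.+1 %[mod q k])%Z.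
Proof. by rewrite -modzNm padic_resS modzNm. Qed.

Lemma padic_add_subproof x y k :
  (padic_res x k + padic_res y k =
   padic_res x k.+1 + padic_res y k.+1 %[mod q k])%Z.
Proof. by rewrite -modzDm 2!padic_resS modzDm. Qed.

Lemma padic_mul_subproof x y k :
  (padic_res x k * padic_res y k =
   padic_res x k.+1 * padic_res y k.+1 %[mod q k])%Z.
Proof. by rewrite -modzMm 2!padic_resS modzMm. Qed.

Definition padic_cst a := PadicInt (padic_of_coherent (padic_cst_subproof a)).
Definition padic_opp x := PadicInt (padic_of_coherent (padic_opp_subproof x)).
Definition padic_add x y :=
  PadicInt (padic_of_coherent (padic_add_subproof x y)).
Definition padic_mul x y :=
  PadicInt (padic_of_coherent (padic_mul_subproof x y)).

HB.instance Definition _ := gen_eqMixin padic_int.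
HB.instance Definition _ := gen_choiceMixin padic_int.

Fact padic_addA : associative padic_add.
Proof. by move=> x y z; apply/padic_intP => k /=; rewrite modzDmr modzDml addrA. Qed.

Fact padic_addC : commutative padic_add.
Proof. by move=> x y; apply/padic_intP => k /=; rewrite addrC. Qed.

Fact padic_add0 : left_id (padic_cst 0) padic_add.
Proof. by move=> x; apply/padic_intP => k /=; rewrite modzDml add0r padic_res_mod. Qed.

Fact padic_addN : left_inverse (padic_cst 0) padic_opp padic_add.
Proof. by move=> x; apply/padic_intP => k /=; rewrite modzDml addNr. Qed.

HB.instance Definition _ := GRing.isZmodule.Build padic_int
  padic_addA padic_addC padic_add0 padic_addN.

Fact padic_mulA : associative padic_mul.
Proof. by move=> x y z; apply/padic_intP => k /=; rewrite modzMmr modzMml mulrA. Qed.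

Fact padic_mulC : commutative padic_mul.
Proof. by move=> x y; apply/padic_intP => k /=; rewrite mulrC. Qed.

Fact padic_mul1 : left_id (padic_cst 1) padic_mul.
Proof. by move=> x; apply/padic_intP => k /=; rewrite modzMml mul1r padic_res_mod. Qed.

Fact padic_mulDl : left_distributive padic_mul padic_add.
Proof. by move=> x y z; apply/padic_intP => k /=; rewrite modzMml modzDm mulrDl. Qed.

HB.instance Definition _ := GRing.Zmodule_isComPzRing.Build padic_int
  padic_mulA padic_mulC padic_mul1 padic_mulDl.

End PadicInt.

(** Up to the choice of a basis, a lattice of rank n is the module of integer
    row vectors of size n with the pairing given by a Gram matrix. *)

Definition pairing n (G : 'M[int]_n) (u v : 'rV[int]_n) : int :=
  (u *m G *m v^T) 0 0.

Record lattice n := Lattice {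
  gram : 'M[int]_n;
  gram_sym : forall u v, pairing gram u v = pairing gram v u;
  gram_nondegenerate : forall u, (forall v, pairing gram u v = 0) -> u = 0 }.

Definition bform n (L : lattice n) := pairing (gram L).

(** [A] is the base ring: the modules obtained from [L] and [M] by extension of
    scalars from Z to [A] are isometric, through [x |-> x *m U]. *)
Definition equivalent_over (A : comPzRingType) n (L M : lattice n) : Prop :=
  exists U V : 'M[A]_n,
    [/\ U *m V = 1%:M, V *m U = 1%:M &
        U *m map_mx intr (gram L) *m U^T = map_mx intr (gram M)].

Definition same_genus (R : realType) n (L M : lattice n) : Prop :=
  equivalent_over R L M /\
  forall p : nat, prime p -> equivalent_over (padic_int p) L M.

(** A genus is a set of lattices; it is closed under isomorphism, so that it is
    the union of the isomorphism classes it consists of. *)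
Definition genus_of (R : realType) n (L : lattice n) : set (lattice n) :=
  [set M | same_genus R L M]%classic.

Definition is_genus (R : realType) n (g : set (lattice n)) : Prop :=
  exists L : lattice n, g = genus_of R L.

Definition positive_definite n (L : lattice n) : Prop :=
  forall u : 'rV[int]_n, u != 0 -> 0 < bform L u u.

Definition idoneal (R : realType) n (g : set (lattice n)) : Prop :=
  [/\ is_genus R g,
      forall L, g L -> positive_definite L &
      forall L, g L -> exists v : 'rV[int]_n, bform L v v = 1].

(** Algorithms: the partial recursive functions, indexed by their arity. *)

Inductive murec : nat -> Type :=
| MuZero k : murec k
| MuSucc : murec 1
| MuProj k (i : 'I_k) : murec k
| MuComp k m (f : murec m) (g : 'I_m -> murec k) : murec k
| MuPrec k (f : murec k) (g : murec k.+2) : murec k.+1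
| MuMin k (f : murec k.+1) : murec k.

(** [computes f v y]: the algorithm [f] halts on the input [v] with output [y].
    - [MuPrec f g] is the function h given by h(0, v) = f(v) and
      h(i + 1, v) = g(i, h(i, v), v); [s] lists the values h(0, v), h(1, v), ...
    - [MuMin f] maps v to the least y such that f(y, v) = 0, provided that f
      halts on (i, v) for all i < y. *)
Fixpoint computes k (f : murec k) : k.-tuple nat -> nat -> Prop :=
  match f in murec k return k.-tuple nat -> nat -> Prop with
  | MuZero _ => fun _ y => y = 0%N
  | MuSucc => fun v y => y = (tnth v ord0).+1
  | MuProj _ i => fun v y => y = tnth v i
  | MuComp _ m f g => fun v y =>
      exists w : m.-tuple nat,
        (forall i, computes (g i) v (tnth w i)) /\ computes f w y
  | MuPrec _ f g => fun v y =>
      exists s : nat -> nat,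
        [/\ computes f [tuple of behead v] (s 0%N),
            forall i, (i < thead v)%N ->
              computes g [tuple of i :: s i :: behead v] (s i.+1) &
            y = s (thead v)]
  | MuMin _ f => fun v y =>
      computes f [tuple of y :: v] 0%N /\
      forall i, (i < y)%N -> exists z, computes f [tuple of i :: v] z.+1
  end.

(** Output format: a genus is represented by the Gram matrix of one of its
    lattices, read row by row; [CodeSeq.code] is a bijective coding of finite
    sequences of natural numbers. *)

Definition code_int (z : int) : nat :=
  match z with Posz m => m.*2 | Negz m => m.*2.+1 end.

Definition code_lattice n (L : lattice n) : nat :=
  CodeSeq.code [seq code_int (gram L i j) | i <- enum 'I_n, j <- enum 'I_n].

Definition code_lattices n (s : seq (lattice n)) : nat :=
  CodeSeq.code [seq code_lattice L | L <- s].

(* Main.v *)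
Require Import Defs.
From mathcomp Require Import all_boot all_order all_algebra.
From mathcomp Require Import boolp classical_sets reals.
From mathcomp Require Import fintype finset perm.
From mathcomp Require Import zify ring.

(** A genus is shown not to be idoneal by exhibiting a p-neighbour without
    vectors of norm 1.  Let v be isotropic modulo p, not orthogonal modulo p to
    any vector of norm 1.  A vector of norm 1 in the neighbour of L at v yields a
    vector of norm p^2 in L congruent to a nonzero multiple of v modulo p.  In an
    orthogonal basis modulo p containing the vectors of norm 1, all coordinates
    of v may be taken nonzero: three of them are solved for, the others are
    free.  Hence v can be chosen as soon as the form has rank at least 3 modulo p
    and either the vectors of norm p^2 lie in a hyperplane modulo p, or they are
    fewer than the available v.

    Let p be the least prime above a constant modulo which the form has rank at
    least 3.  All smaller primes above the constant divide the Gram determinants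
    of triples of vectors of norm p^2, which are at most 6 p^6; so if p is large,
    these vectors span a space of dimension at most 2, and L is not idoneal.
    So, in the idoneal case, p is bounded by an absolute constant and the vectors
    of norm p^2 span a sublattice of finite index with bounded Gram matrix: there
    are finitely many idoneal genera in each rank.  Moreover the number of
    vectors of norm p^2 is polynomial in the rank, while the number of available
    v is exponential: there are no idoneal genera in large rank.  Hence the
    algorithm can be a finite table. *)

Set Implicit Arguments.
Unset Strict Implicit.
Unset Printing Implicit Defensive.

Import Order.TTheory GRing.Theory Num.Theory.

Local Open Scope ring_scope.

(** * Bilinear forms over a commutative ring *)

(** The formula of [pairing] over any commutative ring, for use modulo p as well; over the integers
    the two are convertible, and [change] passes from one to the other. *)
Definition bil (A : comPzRingType) n (G : 'M[A]_n) (u v : 'rV[A]_n) : A :=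
  (u *m G *m v^T) 0 0.

Lemma bilDl (A : comPzRingType) n (G : 'M[A]_n) u v w :
  bil G (u + v) w = bil G u w + bil G v w.
Proof. by rewrite /bil 2!mulmxDl mxE. Qed.

Lemma bilZl (A : comPzRingType) n (G : 'M[A]_n) a u w :
  bil G (a *: u) w = a * bil G u w.
Proof. by rewrite /bil -2!scalemxAl mxE. Qed.

Lemma bilC (A : comPzRingType) n (G : 'M[A]_n) u v :
  G^T = G -> bil G u v = bil G v u.
Proof. by move=> Gs; rewrite /bil -[in LHS]trace_mx11 -mxtrace_tr !trmx_mul Gs trmxK mulmxA trace_mx11. Qed.

Lemma bilDr (A : comPzRingType) n (G : 'M[A]_n) u v w :
  bil G u (v + w) = bil G u v + bil G u w.
Proof. by rewrite /bil linearD mulmxDr mxE. Qed.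

Lemma bilZr (A : comPzRingType) n (G : 'M[A]_n) a u w :
  bil G u (a *: w) = a * bil G u w.
Proof. by rewrite /bil linearZ -scalemxAr mxE. Qed.

Lemma bil_mulmx (A : comPzRingType) m n (G : 'M[A]_n) (X : 'M_(m, n)) u v :
  bil G (u *m X) (v *m X) = bil (X *m G *m X^T) u v.
Proof. by rewrite /bil trmx_mul !mulmxA. Qed.

Lemma gramE (A : comPzRingType) m k n (G : 'M[A]_n) (X : 'M_(m, n)) (Y : 'M_(k, n)) i j :
  (X *m G *m Y^T) i j = bil G (row i X) (row j Y).
Proof.
rewrite /bil tr_row -row_mul mxE [RHS]mxE.
by apply: eq_bigr => l _; rewrite !mxE.
Qed.

Lemma bil_delta (A : comPzRingType) n (G : 'M[A]_n) i j :
  bil G (delta_mx 0 i) (delta_mx 0 j) = G i j.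
Proof. by rewrite /bil -rowE trmx_delta -colE !mxE. Qed.

Lemma bil_map (A B : comPzRingType) (f : {rmorphism A -> B}) n (G : 'M[A]_n) u v :
  bil (map_mx f G) (map_mx f u) (map_mx f v) = f (bil G u v).
Proof. by rewrite /bil map_trmx -!map_mxM mxE. Qed.

Lemma bil_diag (A : comPzRingType) n (d a b : 'rV[A]_n) :
  bil (diag_mx d) a b = \sum_i d 0 i * (a 0 i * b 0 i).
Proof.
rewrite /bil mul_mx_diag mxE; apply: eq_bigr => i _; rewrite !mxE; ring.
Qed.

Lemma gram_trmx n (L : lattice n) : (gram L)^T = gram L.
Proof.
apply/matrixP => i j; rewrite mxE -2!bil_delta; exact: gram_sym.
Qed.

Lemma gram_det n (L : lattice n) : \det (gram L) != 0.
Proof.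
apply/negP => /eqP /eqP/det0P [v vn0 v0].
case/negP: vn0; apply/eqP/(gram_nondegenerate (l := L)) => u.
by rewrite /pairing v0 mul0mx mxE.
Qed.

Lemma lattice_of_gram n (G : 'M[int]_n) :
  G^T = G -> \det G != 0 -> exists L : lattice n, gram L = G.
Proof.
move=> Gs dG.
have h1 u v : pairing G u v = pairing G v u by exact: (bilC u v Gs).
have h2 u : (forall v, pairing G u v = 0) -> u = 0.
  move=> h; have uG : u *m G = 0.
    apply/rowP => j; have := h (delta_mx 0 j).
    by rewrite /pairing trmx_delta -colE !mxE.
  apply/eqP; apply: contraNT dG => un0.
  by apply/det0P; exists u.
by exists (Lattice h1 h2).
Qed.

(** * Units of the p-adic integers, isometries and reflections *)

(** Bezout inverts d modulo each p^k; an inverse modulo p^k is unique, so these inverses form a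
    coherent family. *)
Lemma padic_int_inv (p : nat) (d : int) : prime p -> ~~ (p %| `|d|)%N ->
  exists c : padic_int p, c * d%:~R = 1.
Proof.
move=> pp pd.
have cop k : coprimez d (p ^ k)%N.
  rewrite coprimezE absz_nat coprime_sym; apply: coprimeXl.
  by rewrite prime_coprime.
have h k : {u : int | (u * d = 1 %[mod (p ^ k)%N])%Z}.
  case: (egcdzP d (p ^ k)%N) => u v; rewrite (eqP (cop k)) => e _.
  exists u; apply/eqP; rewrite eqz_mod_dvd -e.
  by rewrite opprD addNKr rpredN dvdz_mull.
pose f k := sval (h k).
have fP k : (f k * d = 1 %[mod (p ^ k)%N])%Z by exact: (svalP (h k)).
have fc k : (f k = f k.+1 %[mod (p ^ k)%N])%Z.
  have e : (f k.+1 * d = 1 %[mod (p ^ k)%N])%Z.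
    by have /(congr1 (fun a => (a %% (p ^ k)%N)%Z)) := fP k.+1; rewrite !padic_mod_mod.
  apply/eqP; rewrite eqz_mod_dvd.
  have : ((p ^ k)%N %| (f k - f k.+1) * d)%Z.
    by rewrite mulrBl -eqz_mod_dvd fP e.
  by rewrite Gauss_dvdzl // coprimez_sym.
have intrE (a : int) : a%:~R = padic_cst p a :> padic_int p.
  have cD (x y : int) : padic_cst p (x + y) = padic_cst p x + padic_cst p y.
    by apply: padic_intP => k /=; rewrite modzDm.
  have cN (n : nat) : n%:R = padic_cst p n :> padic_int p.
    elim: n => [|n IH]; first exact: padic_intP.
    by rewrite -addn1 natrD IH PoszD cD.
  case: a => n; first exact: cN.
  rewrite NegzE rmorphN /= -[n.+1%:~R]/(n.+1%:R) cN.
  by apply: padic_intP => k /=; rewrite modzNm.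
exists (PadicInt (padic_of_coherent fc)).
rewrite intrE; apply: padic_intP => k /=.
by rewrite modzMm fP.
Qed.

(** Where d and det U are invertible, U / d is an isometry, and the adjugate of U gives its
    inverse. *)
Lemma equivalent_over_int (A : comPzRingType) n (L M : lattice n)
    (U : 'M[int]_n) (d : int) (c c' : A) :
  c * (\det U)%:~R = 1 -> c' * d%:~R = 1 ->
  U *m gram L *m U^T = (d * d) *: gram M -> equivalent_over A L M.
Proof.
move=> cU cd UG.
have e (X : 'M[A]_n) : c' *: (d%:~R *: X) = X by rewrite scalerA cd scale1r.
have dc : c * c' * d%:~R * (\det U)%:~R = 1.
  have -> : c * c' * d%:~R * (\det U)%:~R = (c * (\det U)%:~R) * (c' * d%:~R) by ring.
  by rewrite cU cd mulr1.
exists (c' *: map_mx intr U), ((c * d%:~R) *: map_mx intr (\adj U)); split.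
- rewrite -scalemxAl -scalemxAr -map_mxM mul_mx_adj map_scalar_mx /= scalerA.
  by rewrite scale_scalar_mx; congr (_%:M); rewrite -[RHS]dc; ring.
- rewrite -scalemxAl -scalemxAr -map_mxM mul_adj_mx map_scalar_mx /= scalerA.
  by rewrite scale_scalar_mx; congr (_%:M); rewrite -[RHS]dc; ring.
- rewrite linearZ /= -scalemxAr -!scalemxAl map_trmx -!map_mxM UG.
  by rewrite map_mxZ rmorphM /= -scalerA e e.
Qed.

(** N is the reflection in w cleared of its denominator, the norm of w. *)
Lemma reflection_gram (A : comPzRingType) n (G : 'M[A]_n) (w : 'rV[A]_n) :
  G^T = G ->
  let N := (bil G w w)%:M - 2 *: (G *m w^T *m w) in
  N *m G *m N^T = (bil G w w * bil G w w) *: G.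
Proof.
move=> Gs N; set q := bil G w w.
have wGw : w *m (G *m w^T) = q%:M.
  by apply/matrixP => i j; rewrite !ord1 mulmxA [RHS]mxE eqxx mulr1n.
pose g := G *m w^T.
have wG : w *m G = g^T by rewrite trmx_mul trmxK Gs.
have NT : N^T = q%:M - 2 *: (w^T *m g^T).
  by rewrite /N linearB /= linearZ /= tr_scalar_mx trmx_mul.
have NG : N *m G = q *: G - 2 *: (g *m g^T).
  by rewrite mulmxBl mul_scalar_mx -scalemxAl -(mulmxA (G *m w^T)) wG.
have gg : g *m g^T *m w^T *m g^T = q *: (g *m g^T).
  have gw : g^T *m w^T = q%:M by rewrite -wG -mulmxA wGw.
  by rewrite -(mulmxA g) gw mul_mx_scalar -scalemxAl.
rewrite NG NT mulmxBr mul_mx_scalar -scalemxAr mulmxBl -!scalemxAl.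
rewrite !mulmxA -/g gg.
rewrite !scalerBr !scalerA opprB addrA.
apply/matrixP => i j; rewrite !mxE; ring.
Qed.

(** * Unimodular bases adapted to a vector *)

Lemma row_primitive_basis n (v : 'rV[int]_n.+1) :
  exists2 B : 'M[int]_n.+1, B \in unitmx & exists c, v = c *: row 0 B.
Proof.
have [l _ [B uB [d _ ->]]] := int_Smith_normal_form v.
exists B => //; exists (l 0 0 * d`_0).
have -> : l *m \matrix_(i < 1, j < n.+1) (d`_i *+ (i == j :> nat)) =
    (l 0 0 * d`_0) *: delta_mx 0 0.
  apply/rowP => j; rewrite !mxE big_ord1 !mxE -mulrA; congr (_ * _).
  by rewrite [RHS]mulr_natr eq_sym.
by rewrite -scalemxAl -rowE.
Qed.

(** Two uses of [row_primitive_basis]: on v, which gives f_0, then on the products r of f_0 with the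
    other basis vectors. The base change dual to the second one leaves, among f_1, f_2, ..., only
    f_1 with a possibly nonzero product. *)
Lemma adapted_basis m (G : 'M[int]_m.+2) (v : 'rV[int]_m.+2) :
  exists2 B : 'M[int]_m.+2, B \in unitmx &
    (exists c, v = c *: row 0 B) /\
    (forall i : 'I_m.+2, (1 < i)%N -> bil G (row 0 B) (row i B) = 0).
Proof.
have [B uB [c vc]] := row_primitive_basis v.
pose r : 'rV[int]_m.+1 := \row_j bil G (row 0 B) (row (lift ord0 j) B).
have [C uC [c' rc]] := row_primitive_basis r.
pose S : 'M_(1 + m.+1) := block_mx 1%:M 0 0 (invmx C)^T.
have l0 : ord0 = lshift m.+1 (ord0 : 'I_1) by apply: val_inj.
have r1 k : lift ord0 k = rshift 1 (k : 'I_m.+1) by apply: val_inj.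
have rS : row 0 (S *m B) = row 0 B.
  rewrite row_mul; have -> : row 0 S = delta_mx 0 0; last by rewrite -rowE.
  apply/rowP => j; rewrite mxE [RHS]mxE; change (S ord0 j = (j == ord0)%:R).
  case: (unliftP ord0 j) => [k|] ->.
    by rewrite r1 l0 block_mxEur mxE.
  by rewrite eqxx l0 block_mxEul mxE.
exists (S *m B).
  rewrite unitmx_mul uB andbT unitmxE /S (@det_ublock _ 1 m.+1) det1 mul1r det_tr -unitmxE.
  by rewrite unitmx_inv.
rewrite rS; split; first by exists c.
move=> i; case: (unliftP ord0 i) => [k|] -> //; rewrite lift0 ltnS => k0.
have -> : bil G (row 0 B) (row (lift ord0 k) (S *m B)) = (r *m invmx C) 0 k.
  have E j : (row 0 B *m G *m B^T) 0 j = bil G (row 0 B) (row j B).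
    by rewrite gramE row_id.
  rewrite row_mul {1}/bil trmx_mul mulmxA mxE big_ord_recl E.
  rewrite [X in _ * X]mxE [row _ S _ _]mxE.
  have Sk j : S (lift ord0 k) (lift ord0 j) = invmx C j k.
    by rewrite !r1 block_mxEdr mxE.
  have S0 : S (lift ord0 k) ord0 = 0.
    by rewrite r1 l0 block_mxEdl mxE.
  rewrite S0 mulr0 add0r [RHS]mxE.
  apply: eq_bigr => j _.
  by rewrite E [_^T _ _]mxE [row _ S _ _]mxE Sk [r _ _]mxE.
rewrite rc -scalemxAl -row_mul mulmxV // row1 !mxE eqxx /=.
by case: eqP k0 => [->|_]; rewrite ?mulr0.
Qed.

(** * Being in the same genus is an equivalence relation *)

Lemma equivalent_over_trans (A : comPzRingType) n (L M N : lattice n) :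
  equivalent_over A L M -> equivalent_over A M N -> equivalent_over A L N.
Proof.
move=> [U [V [UV VU e]]] [U' [V' [UV' VU' e']]].
exists (U' *m U), (V *m V'); split.
- by rewrite mulmxA -(mulmxA U') UV mulmx1.
- by rewrite mulmxA -(mulmxA V) VU' mulmx1.
- by rewrite trmx_mul !mulmxA -(mulmxA U') -(mulmxA U') e.
Qed.

Lemma equivalent_over_sym (A : comPzRingType) n (L M : lattice n) :
  equivalent_over A L M -> equivalent_over A M L.
Proof.
move=> [U [V [UV VU e]]]; exists V, U; split=> //.
by rewrite -e !mulmxA VU mul1mx -mulmxA -trmx_mul VU trmx1 mulmx1.
Qed.

Lemma same_genus_unimodular (R : realType) n (L M : lattice n) (B : 'M[int]_n) :
  B \in unitmx -> B *m gram L *m B^T = gram M -> same_genus R L M.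
Proof.
rewrite unitmxE unitrE => /eqP uB e.
suff h (A : comPzRingType) : equivalent_over A L M by split.
apply: (@equivalent_over_int A _ _ _ B 1 ((\det B)^-1)%:~R 1).
- by rewrite -rmorphM /= mulrC uB.
- by rewrite mul1r.
- by rewrite mulr1 scale1r.
Qed.

Lemma same_genus_trans (R : realType) n (L M N : lattice n) :
  same_genus R L M -> same_genus R M N -> same_genus R L N.
Proof.
move=> [r h] [r' h']; split; first exact: equivalent_over_trans r'.
by move=> p pp; apply: equivalent_over_trans (h p pp) (h' p pp).
Qed.

Lemma same_genus_sym (R : realType) n (L M : lattice n) :
  same_genus R L M -> same_genus R M L.
Proof.
move=> [r h]; split; first exact: equivalent_over_sym.
by move=> p pp; apply: equivalent_over_sym (h p pp).
Qed.

Lemma same_genus_refl (R : realType) n (L : lattice n) : same_genus R L L.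
Proof.
by apply: (@same_genus_unimodular R n L L 1%:M);
  rewrite ?unitmx1 // mul1mx trmx1 mulmx1.
Qed.

(** * Neighbours of a lattice at an odd prime *)

(* The neighbour is spanned by f_0 / p, p f_1, f_2, ..., where f_i is the
   standard basis.  Away from p it is identified with L by this change of basis;
   at p, composing it with the reflection in w = f_0 + p f_1, whose norm is p
   times a unit, cancels the denominators. *)
Lemma neighbour_adapted (R : realType) m (L : lattice m.+2) (p : nat) (a : int) :
  prime p -> odd p ->
  gram L 0 0 = p%:Z * p%:Z * a -> ~~ (p %| gram L 0%R 1%R)%Z ->
  (forall i : 'I_m.+2, (1 < i)%N -> gram L 0 i = 0) ->
  exists2 L' : lattice m.+2, same_genus R L L' &
    forall y, bform L' y y = 1 ->
      (exists2 x, bform L x x = 1 & (p %| bform L x (delta_mx 0 0)%R)%Z) \/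
      (exists j z, ~~ (p %| j)%Z /\
        let w := j *: delta_mx 0 0 + p%:Z *: z in bform L w w = p%:Z * p%:Z).
Proof.
move=> pp po G00 pG01 G0; set G := gram L in G00 pG01 G0 *.
have Gs : G^T = G by exact: gram_trmx.
have GC i j : G i j = G j i by rewrite -{1}Gs mxE.
have p0 : p%:Z != 0 by rewrite -lt0n prime_gt0.
have pz0 : p%:Z * p%:Z != 0 by rewrite mulf_neq0.
pose f0 : 'rV[int]_m.+2 := delta_mx 0 0.
pose f1 : 'rV[int]_m.+2 := delta_mx 0 1.
(* [diag_mx D] is p times the base change to f_0 / p, p f_1, f_2, ..., so that its entries are
   integers. *)
pose D : 'rV[int]_m.+2 :=
  \row_i (if i == 0 then 1 else if i == 1 then p%:Z * p%:Z else p%:Z).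
have D0 : D 0 0 = 1 by rewrite mxE.
have D1 : D 0 1 = p%:Z * p%:Z by rewrite mxE.
have Di (i : 'I_m.+2) : (1 < i)%N -> D 0 i = p%:Z by rewrite mxE; case: i => [[|[|i]] ?].
have casei (i : 'I_m.+2) : [\/ i = 0, i = 1 | (1 < i)%N].
  case: i => [[|[|i]] hi]; [constructor 1|constructor 2|constructor 3] => //; exact: val_inj.
have ne01 (i : 'I_m.+2) : (1 < i)%N -> i != 0 /\ i != 1.
  by move=> hi; split; apply: contraTneq hi => ->.
have dvG i j : (p%:Z * p%:Z %| D 0%R i * D 0%R j * G i j)%Z.
  wlog : i j / ~~ ((1 < i)%N && (j < 2)%N) => [hw|].
    have [/andP [hi hj]|] := boolP ((1 < i)%N && (j < 2)%N); last exact: hw.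
    by rewrite [_ * D 0%R j]mulrC GC; apply: hw; rewrite negb_and -!leqNgt hi orbT.
  case: (casei i) => [->|->|hi]; case: (casei j) => [->|->|hj] //.
  - by rewrite D0 G00 !mul1r dvdz_mulr.
  - by rewrite D0 D1 mul1r dvdz_mulr.
  - by rewrite G0 // mulr0 dvdz0.
  - by rewrite D1 -mulrA dvdz_mulr.
  - by rewrite D1 -mulrA dvdz_mulr.
  - by rewrite D1 -mulrA dvdz_mulr.
  - by rewrite hi.
  - by rewrite hi.
  - by rewrite !Di // dvdz_mulr.
pose G' : 'M[int]_m.+2 := \matrix_(i, j) ((D 0%R i * D 0%R j * G i j) %/ (p%:Z * p%:Z))%Z.
have G'E : (p%:Z * p%:Z) *: G' = diag_mx D *m G *m diag_mx D.
  apply/matrixP => i j; rewrite mul_mx_diag mul_diag_mx !mxE mulrC divzK.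
    by rewrite mulrAC.
  by have := dvG i j; rewrite !mxE.
have detD : \det (diag_mx D) = p%:Z ^+ m.+2.
  rewrite det_diag big_ord_recl big_ord_recl D0 mul1r.
  have -> : lift ord0 ord0 = 1 :> 'I_m.+2 by exact: val_inj.
  rewrite D1 (eq_bigr (fun _ => p%:Z)); last by move=> i _; rewrite Di.
  by rewrite prodr_const card_ord -mulrA -!exprS.
have detG' : \det G' = \det G.
  apply: (mulfI (expf_neq0 m.+2 pz0)).
  by rewrite -detZ G'E !det_mulmx detD exprMn; ring.
have G's : G'^T = G'.
  by apply/matrixP => i j; rewrite mxE [LHS]mxE [RHS]mxE GC [D 0%R j * _]mulrC.
have [L' L'E] := lattice_of_gram G's (etrans (congr1 (fun x => x != 0) detG') (gram_det L)).
have bG x y : bil G (x *m diag_mx D) (y *m diag_mx D) = p%:Z * p%:Z * bil G' x y.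
  by rewrite bil_mulmx tr_diag_mx -G'E /bil -scalemxAr -scalemxAl mxE.
have Gf0 x : bil G x f0 = x 0 0 * (p%:Z * p%:Z * a) + x 0 1 * G 0 1.
  rewrite bilC // /bil -rowE mxE (bigD1 0) //= (bigD1 1) //= big1 => [|i /andP [i0 i1]].
    by rewrite !mxE G00 addr0; ring.
  by rewrite !mxE G0 ?mul0r //; case: (casei i) i0 i1 => [->|->|].
exists L'; last first.
  move=> y; rewrite /bform L'E => y1.
  have bE : bil G (y *m diag_mx D) (y *m diag_mx D) = p%:Z * p%:Z by rewrite bG [bil _ _ _]y1 mulr1.
  (* If p divides y_0, the vector of coordinates y lies in L and its coordinate along f_1 is
     divisible by p, hence so is its product with f_0. Otherwise p times it is congruent to y_0 f_0
     modulo p. *)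
  have [py|npy] := boolP (p%:Z %| y 0%R 0%R)%Z; [left|right].
    pose x : 'rV[int]_m.+2 := \row_i (if i == 0 then (y 0%R 0%R %/ p)%Z else if i == 1 then p%:Z * y 0 1 else y 0 i).
    have xE : y *m diag_mx D = p%:Z *: x.
      apply/rowP => i; rewrite mul_mx_diag !mxE; case: (casei i) => [->|->|hi] /=.
      - by rewrite mulr1 mulrC divzK.
      - ring.
      - by have := Di i hi; rewrite mxE => ->; case: i hi => [[|[|i]] ?] //= _; rewrite mulrC.
    exists x.
      change (bil G x x = 1).
      by apply: (mulfI pz0); rewrite mulr1 -[in RHS]bE xE bilZl bilZr mulrA.
    change (p%:Z %| bil G x f0)%Z; rewrite Gf0 [x 0 1]mxE /= -!mulrA.
    by apply: rpredD; [apply: dvdz_mull|]; apply: dvdz_mulr.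
  pose z : 'rV[int]_m.+2 := \row_i (if i == 0 then 0 else if i == 1 then p%:Z * y 0 1 else y 0 i).
  exists (y 0 0), z; split => //.
  change (let w := y 0 0 *: f0 + p%:Z *: z in bil G w w = p%:Z * p%:Z).
  suff -> : y 0 0 *: f0 + p%:Z *: z = y *m diag_mx D by [].
  apply/rowP => i; rewrite mul_mx_diag !mxE; case: (casei i) => [->|->|hi] /=.
  - by rewrite mulr0 addr0.
  - ring.
  - by have := Di i hi; rewrite mxE => ->; case: i hi => [[|[|i]] ?] //= _; rewrite mulr0 add0r mulrC.
split.
  apply: (@equivalent_over_int R _ _ _ (diag_mx D) p (p%:R ^- m.+2) (p%:R^-1)).
  - by rewrite detD rmorphXn /= -[p%:~R]/(p%:R) mulVf // expf_neq0 // pnatr_eq0 -lt0n prime_gt0.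
  - by rewrite -[p%:~R]/(p%:R) mulVf // pnatr_eq0 -lt0n prime_gt0.
  - by rewrite tr_diag_mx L'E G'E.
move=> q pq; have [eqp|nqp] := eqVneq q p; last first.
  have qp : ~~ (q %| `|p%:Z|)%N by rewrite absz_nat dvdn_prime2.
  have [c cE] := padic_int_inv pq qp.
  apply: (@equivalent_over_int _ _ _ _ (diag_mx D) p (c ^+ m.+2) c) => //.
  - by rewrite detD rmorphXn /= -exprMn cE expr1n.
  - by rewrite tr_diag_mx L'E G'E.
subst q.
pose w := f0 + p%:Z *: f1.
(* Modulo p this is 2 b(f_0, f_1), a unit since p is odd. *)
pose mu := p%:Z * a + 2 * G 0 1 + p%:Z * G 1 1.
have ww : bil G w w = p%:Z * mu.
  by rewrite !bilDl !bilDr !bilZl !bilZr !bil_delta G00 [G 1 0]GC /mu; ring.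
have w0 : w 0 0 = 1 by rewrite !mxE /= mulr0 addr0.
have w1 : w 0 1 = p%:Z by rewrite !mxE /= mulr1 add0r.
have wi (i : 'I_m.+2) : (1 < i)%N -> w 0 i = 0.
  case/ne01 => i0 i1; rewrite !mxE (negbTE i0) (negbTE i1) /=; ring.
pose N := (p%:Z * mu)%:M - 2 *: (G *m w^T *m w).
have NG : N *m G *m N^T = (p%:Z * mu * (p%:Z * mu)) *: G.
  by have /= := reflection_gram w Gs; rewrite ww.
have Gw i : (G *m w^T) i 0 = G i 0 + p%:Z * G i 1.
  rewrite linearD linearZ /= !trmx_delta mulmxDr -scalemxAr -!colE.
  by rewrite !mxE.
have NE i j : N i j = p%:Z * mu *+ (i == j) - 2 * ((G i 0 + p%:Z * G i 1) * w 0 j).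
  by rewrite [LHS]mxE [_%:M i j]mxE [X in _ + X]mxE [X in - X]mxE [X in 2 * X]mxE big_ord1 Gw.
have dvN i j : (p%:Z * p%:Z %| D 0%R i * N i j)%Z.
  rewrite NE; case: (casei i) => [->|->|hi].
  - rewrite D0 mul1r G00; case: (casei j) => [->|->|hj].
    + rewrite w0 eqxx mulr1n mulr1 /mu.
      have -> : p%:Z * (p%:Z * a + 2 * G 0 1 + p%:Z * G 1 1) -
        2 * (p%:Z * p%:Z * a + p%:Z * G 0 1) = p%:Z * p%:Z * (G 1 1 - a) by ring.
      exact: dvdz_mulr.
    + rewrite w1 mulr0n add0r rpredN.
      have -> : 2 * ((p%:Z * p%:Z * a + p%:Z * G 0 1) * p%:Z) =
        p%:Z * p%:Z * (2 * (p%:Z * a + G 0 1)) by ring.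
      exact: dvdz_mulr.
    + by rewrite wi // !mulr0 subr0 eq_sym (negbTE (proj1 (ne01 j hj))) mulr0n dvdz0.
  - by rewrite D1 dvdz_mulr.
  - rewrite Di // [G i 0]GC G0 // add0r -!mulrA dvdz_mul // mulrCA.
    by rewrite -mulrnAr -mulrBr dvdz_mulr.
(* [diag_mx D] is p times the base change and N is p mu times the reflection, so U is mu times their
   product. *)
pose U : 'M[int]_m.+2 := \matrix_(i, j) ((D 0%R i * N i j) %/ (p%:Z * p%:Z))%Z.
have UE : (p%:Z * p%:Z) *: U = diag_mx D *m N.
  apply/matrixP => i j; by rewrite mul_diag_mx [LHS]mxE [U i j]mxE [RHS]mxE mulrC divzK.
have UG : U *m G *m U^T = (mu * mu) *: G'.
  have h : (p%:Z * p%:Z) *: ((p%:Z * p%:Z) *: (U *m G *m U^T)) =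
    (p%:Z * p%:Z) *: ((p%:Z * p%:Z) *: ((mu * mu) *: G')).
    have -> : (p%:Z * p%:Z) *: ((p%:Z * p%:Z) *: (U *m G *m U^T)) =
        ((p%:Z * p%:Z) *: U) *m G *m ((p%:Z * p%:Z) *: U)^T.
      by rewrite [(_ *: U)^T]linearZ /= -scalemxAr -!scalemxAl.
    rewrite UE trmx_mul tr_diag_mx !mulmxA -(mulmxA (diag_mx D)) -(mulmxA (diag_mx D)) NG.
    rewrite -scalemxAr -scalemxAl -G'E !scalerA; congr (_ *: _); ring.
  by apply: (scalemx_inj pz0); apply: (scalemx_inj pz0).
have pmu : ~~ (p %| `|mu|)%N.
  apply: contra pG01 => pm.
  have : (p %| `|(2 * G 0 1)%R|)%N.
    suff: (p%:Z %| 2 * G 0%R 1%R)%Z by [].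
    have -> : 2 * G 0 1 = mu - p%:Z * (a + G 1 1) by rewrite /mu; ring.
    by apply: rpredB; [exact: pm | exact: dvdz_mulr].
  rewrite abszM Euclid_dvdM // => /orP [p2|//].
  by move: p2 po; rewrite dvdn_prime2 // => /eqP ->.
(* L and the neighbour have the same determinant, so det U is a power of mu up to sign. *)
have pU : ~~ (p %| `|\det U|)%N.
  have : (\det U) ^+ 2 = (mu * mu) ^+ m.+2.
    apply: (mulIf (gram_det L)).
    have := congr1 determinant UG; rewrite !det_mulmx det_tr detZ detG' => <-.
    rewrite -/G; ring.
  move=> h; apply: contra pmu => pd.
  have : (p %| `|(\det U) ^+ 2|)%N by rewrite abszX expnS dvdn_mulr.
  by rewrite h abszX Euclid_dvdX // andbT abszM Euclid_dvdM // orbb.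
have [c cE] := padic_int_inv pp pU.
have [c' c'E] := padic_int_inv pp pmu.
by apply: (equivalent_over_int cE c'E); rewrite L'E.
Qed.

Lemma bezout_mod (p : nat) (c : int) : prime p -> ~~ (p %| c)%Z ->
  exists d e : int, c * d = 1 + p%:Z * e.
Proof.
move=> pp pc; have cop : coprimez c p.
  by rewrite coprimezE absz_nat coprime_sym prime_coprime.
case: (egcdzP c p) => u v; rewrite (eqP cop) => e _.
by exists u, (- v); rewrite -e; ring.
Qed.

(** Since 2 b(v, u) is a unit modulo p, v can be moved within its class modulo p to a vector v_1 of
    norm divisible by p^2; a basis adapted to v_1 reduces to [neighbour_adapted]. *)
Lemma neighbour (R : realType) m (L : lattice m.+2) (p : nat)
    (v u : 'rV[int]_m.+2) :
  prime p -> odd p -> (p %| bform L v v)%Z -> ~~ (p %| bform L v u)%Z ->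
  exists2 L' : lattice m.+2, same_genus R L L' &
    forall y, bform L' y y = 1 ->
      (exists2 x, bform L x x = 1 & (p %| bform L x v)%Z) \/
      (exists j z, ~~ (p %| j)%Z /\
        let w := j *: v + p%:Z *: z in bform L w w = p%:Z * p%:Z).
Proof.
move=> pp po; set G := gram L.
change ((p %| bil G v v)%Z -> ~~ (p %| bil G v u)%Z -> 
  exists2 L' : lattice m.+2, same_genus R L L' &
    forall y, bform L' y y = 1 ->
      (exists2 x, bil G x x = 1 & (p %| bil G x v)%Z) \/
      (exists j z, ~~ (p %| j)%Z /\
        let w := j *: v + p%:Z *: z in bil G w w = p%:Z * p%:Z)).
move=> /dvdzP [k vk] pvu.
have Gs : G^T = G by exact: gram_trmx.
have p2vu : ~~ (p %| 2 * bil G v u)%Z.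
  apply: contra pvu => h.
  have : (p %| `|(2 * bil G v u)%R|)%N by exact: h.
  rewrite abszM Euclid_dvdM // => /orP [p2|//].
  by move: p2 po; rewrite dvdn_prime2 // => /eqP ->.
have [s [s' ss']] := bezout_mod pp p2vu.
(* Modulo p^2 the norm of v + p t u is p (k + 2 t b(v, u)), and s inverts 2 b(v, u) modulo p. *)
pose t := - k * s; pose v1 := v + (p%:Z * t) *: u.
have v1v1 : (p%:Z * p%:Z %| bil G v1 v1)%Z.
  have -> : bil G v1 v1 = p%:Z * p%:Z * (t * t * bil G u u - k * s').
    rewrite !bilDl !bilDr !bilZl !bilZr (bilC u v Gs) vk.
    have -> : k * p%:Z + p%:Z * t * bil G v u + (p%:Z * t * bil G v u +
       p%:Z * t * (p%:Z * t * bil G u u)) =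
      k * p%:Z + p%:Z * (- k * (2 * bil G v u * s)) + p%:Z * t * (p%:Z * t * bil G u u).
      by rewrite /t; ring.
    by rewrite ss'; ring.
  exact: dvdz_mulr.
have pv1u : ~~ (p %| bil G v1 u)%Z.
  by rewrite bilDl bilZl -mulrA rpredDr ?dvdz_mulr.
have [B uB [[c vc] Bi]] := adapted_basis G v1.
set r0 := row 0 B in vc Bi.
have G1s : (B *m G *m B^T)^T = B *m G *m B^T by rewrite !trmx_mul trmxK Gs mulmxA.
have dG1 : \det (B *m G *m B^T) != 0.
  move: (uB); rewrite unitmxE unitrE => /eqP uB'.
  rewrite !det_mulmx det_tr !mulf_neq0 ?gram_det //;
  by apply: contra_eq_neq uB' => ->; rewrite mul0r eq_sym oner_eq0.
have [L1 L1E] := lattice_of_gram G1s dG1.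
have gL1 : same_genus R L L1 by apply: same_genus_unimodular uB _; rewrite L1E.
have G1E x y : bform L1 x y = bil G (x *m B) (y *m B).
  by rewrite bil_mulmx /bform L1E.
have G1ij i j : gram L1 i j = bil G (row i B) (row j B) by rewrite L1E gramE.
have pc : ~~ (p %| c)%Z.
  by apply: contra pv1u => pc; rewrite vc bilZl dvdz_mulr.
have cop2 : coprimez (p%:Z * p%:Z) (c * c).
  have h : coprimez p c by rewrite coprimezE absz_nat prime_coprime.
  by rewrite coprimezMl !coprimezMr h.
have /dvdzP [a aE] : (p%:Z * p%:Z %| bil G r0 r0)%Z.
  by rewrite -(Gauss_dvdzr _ cop2) -mulrA -bilZl -bilZr -vc.
have G00 : gram L1 0 0 = p%:Z * p%:Z * a by rewrite G1ij -/r0 aE mulrC.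
have G0i (i : 'I_m.+2) : (1 < i)%N -> gram L1 0 i = 0.
  by move=> hi; rewrite G1ij Bi.
have G01 : ~~ (p %| gram L1 0%R 1%R)%Z.
  apply: contra pv1u => h; rewrite vc bilZl dvdz_mull //.
  have -> : bil G r0 u = bform L1 (delta_mx 0 0) (u *m invmx B).
    by rewrite G1E mulmxKV // -rowE.
  change (p %| bil (gram L1) (delta_mx 0 0)%R (u *m invmx B)%R)%Z.
  rewrite /bil -rowE mxE big_ord_recl big_ord_recl big1 => [|i _].
    rewrite addr0 ![row _ _ _ _]mxE.
    have -> : lift ord0 ord0 = 1 :> 'I_m.+2 by apply: val_inj.
    apply: rpredD; apply: dvdz_mulr => //.
    have -> : gram L1 0 ord0 = p%:Z * p%:Z * a by exact: G00.
    by rewrite -mulrA dvdz_mulr.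
  by rewrite [row _ _ _ _]mxE G0i // mul0r.
have [L' gL' hL'] := neighbour_adapted R pp po G00 G01 G0i.
exists L'; first exact: same_genus_trans gL1 gL'.
have r0E : delta_mx 0 0 *m B = r0 by rewrite -rowE.
move=> y /hL' [[x x1 px]|[j [z [pj /= wz]]]]; [left|right].
  exists (x *m B); first by rewrite -G1E.
  have -> : v = c *: r0 - (p%:Z * t) *: u by rewrite -vc /v1 addrK.
  rewrite bilDr -scaleNr !bilZr mulNr -mulrA.
  apply: rpredB; last exact: dvdz_mulr.
  by apply: dvdz_mull; rewrite -r0E -G1E.
(* From v_1 = c r_0 and c d = 1 + p e follows j r_0 = j d v_1 - p j e r_0: the multiplier of v is j
   d. *)
have [d [e de]] := bezout_mod pp pc.
exists (j * d), ((j * d * t) *: u - (j * e) *: r0 + z *m B); split.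
  apply/negP => h; have : (p %| `|(j * d)%R|)%N by exact: h.
  rewrite abszM Euclid_dvdM // => /orP [h1|h2]; first by case/negP: pj; exact: h1.
  have : (p%:Z %| c * d)%Z by apply: dvdz_mull; exact: h2.
  rewrite de rpredDr ?dvdz_mulr // => h3.
  have : (p %| `|1%:Z|)%N by exact: h3.
  by rewrite /= dvdn1 => /eqP p1; move: pp; rewrite p1.
rewrite -wz G1E mulmxDl -!scalemxAl r0E /=.
suff -> : (j * d) *: v + p%:Z *: ((j * d * t) *: u - (j * e) *: r0 + z *m B) =
   j *: r0 + p%:Z *: (z *m B) by [].
have -> : v = c *: r0 - (p%:Z * t) *: u by rewrite -vc /v1 addrK.
have -> : j *: r0 = (j * (c * d) - j * (p%:Z * e)) *: r0.
  by rewrite de; congr (_ *: _); ring.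
apply/rowP => i; rewrite !mxE; ring.
Qed.

(** * Orthogonal bases over a field where 2 is nonzero *)

(** The linear form b(., e) is nonzero at e, so its kernel has dimension n; rewriting with this rank
    gives Y the literal size n that an induction on the dimension needs. *)
Lemma orthogonal_complement_basis (F : fieldType) n (B : 'M[F]_n.+1) (e : 'rV_n.+1) :
  bil B e e != 0 ->
  exists Y : 'M_(n, n.+1),
    (forall x, bil B x e = 0 -> (x <= Y)%MS) /\
    (forall i, bil B (row i Y) e = 0).
Proof.
move=> ee; pose K := kermx (B *m e^T).
have rk : \rank (B *m e^T) = 1%N.
  apply/eqP; rewrite eqn_leq rank_leq_col lt0n mxrank_eq0.
  by apply: contraNneq ee => h; rewrite /bil -mulmxA h mulmx0 mxE.
have rkK : \rank K = n by rewrite mxrank_ker rk subn1.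
have h1 x : bil B x e = 0 -> (x <= row_base K)%MS.
  move=> xe; rewrite eq_row_base; apply/sub_kermxP.
  by apply/matrixP => i j; rewrite !ord1 mulmxA [RHS]mxE.
have h2 i : bil B (row i (row_base K)) e = 0.
  have /sub_kermxP : (row i (row_base K) <= K)%MS.
    by rewrite (submx_trans (row_sub _ _)) // eq_row_base.
  by rewrite /bil -mulmxA => ->; rewrite mxE.
by move: (row_base K) h1 h2; rewrite rkK => Y h1 h2; exists Y.
Qed.

Lemma polarization_zero (F : fieldType) n (B : 'M[F]_n) :
  2 != 0 :> F -> B^T = B -> (forall x, bil B x x = 0) -> B = 0.
Proof.
move=> F2 Bs h; apply/matrixP => i j; rewrite mxE -bil_delta.
have := h (delta_mx 0 i + delta_mx 0 j).
rewrite bilDl !bilDr !h (bilC (delta_mx 0 j) _ Bs) addr0 add0r -mulr2n.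
by move/eqP; rewrite -mulr_natl mulf_eq0 (negbTE F2) => /eqP.
Qed.

(** Induction on the dimension: split off a vector of [es], or any vector of nonzero norm if [es] is
    empty. When there is none, the form is zero by polarization. The form may be degenerate. *)
Lemma orthogonal_basis (F : fieldType) n (B : 'M[F]_n) (es : seq 'rV[F]_n) :
  2 != 0 :> F -> B^T = B -> {in es, forall e, bil B e e != 0} ->
  {in es &, forall e e', e != e' -> bil B e e' = 0} ->
  exists2 T : 'M_n, T \in unitmx &
    (exists d, T *m B *m T^T = diag_mx d) /\
    {in es, forall e, exists i, row i T = e}.
Proof.
move=> F2; elim: n B es => [|n IH] B es Bs nz orth.
  exists 1%:M; first exact: unitmx1.
  split; first by exists 0; apply/matrixP => - [].
  by move=> e /nz; rewrite /bil mxE big_ord0 eqxx.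
have main (fs : seq 'rV[F]_n.+1) e : e \in fs ->
    {in fs, forall e, bil B e e != 0} ->
    {in fs &, forall e e', e != e' -> bil B e e' = 0} ->
  exists2 T : 'M_n.+1, T \in unitmx &
    (exists d, T *m B *m T^T = diag_mx d) /\
    {in fs, forall e, exists i, row i T = e}.
  move=> efs fnz forth; have ee := fnz _ efs.
  have [Y [Yc Ye]] := orthogonal_complement_basis ee.
  pose B1 := Y *m B *m Y^T.
  have B1s : B1^T = B1 by rewrite !trmx_mul trmxK Bs mulmxA.
  pose es1 := [seq x *m pinvmx Y | x <- fs & x != e].
  have fsE x : x \in fs -> x != e -> x *m pinvmx Y *m Y = x.
    by move=> xfs xe; apply/mulmxKpV/Yc/forth.
  have [||T1 uT1 [[d1 dE] rowT1]] := IH B1 es1 B1s.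
  - move=> _ /mapP [x + ->]; rewrite mem_filter => /andP [xe xfs].
    by rewrite -bil_mulmx fsE //; apply: fnz.
  - move=> _ _ /mapP [x + ->] /mapP [x' + ->].
    rewrite !mem_filter => /andP [xe xfs] /andP [x'e x'fs] ne.
    by rewrite -bil_mulmx !fsE //; apply: forth => //; apply: contraNneq ne => ->.
  pose T : 'M_(1 + n, n.+1) := col_mx e (T1 *m Y).
  have YT : (T1 *m Y <= T)%MS by rewrite -addsmxE addsmxSr.
  have eT : (e <= T)%MS by rewrite -addsmxE addsmxSl.
  have uT : (T : 'M_n.+1) \in unitmx.
    rewrite -row_full_unit -sub1mx; apply/row_subP => i; set x := row i _.
    pose a := bil B x e / bil B e e.
    rewrite -[x](subrK (a *: e)) addmx_sub ?scalemx_sub //.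
    have : (x - a *: e <= Y)%MS.
      by apply: Yc; rewrite -scaleNr bilDl bilZl mulNr divfK ?subrr.
    move/submx_trans; apply; apply: submx_trans YT.
    by rewrite -[X in (X <= _)%MS](mulKmx uT1) submxMl.
  have YeT : Y *m B *m e^T = 0.
    by apply/matrixP => i j; rewrite !ord1 gramE row_id Ye mxE.
  have eYT : e *m B *m Y^T = 0.
    by apply: trmx_inj; rewrite trmx0 !trmx_mul trmxK Bs mulmxA.
  exists T => //; split.
    suff h : T *m B *m T^T = diag_mx (row_mx (const_mx (bil B e e) : 'rV_1) d1).
      by exists (row_mx (const_mx (bil B e e) : 'rV_1) d1).
    rewrite diag_mx_row /T tr_col_mx mul_col_mx mul_col_row -dE trmx_mul.
    congr block_mx.
    - by apply/matrixP => i j; rewrite !ord1 gramE !row_id [RHS]mxE mxE.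
    - by rewrite mulmxA eYT mul0mx.
    - by rewrite -!mulmxA (mulmxA Y) YeT mulmx0.
    - by rewrite /B1 !mulmxA.
  move=> x xfs; have [->|xe] := eqVneq x e.
    have h : row (lshift n (0 : 'I_1)) T = e by rewrite rowKu row_id.
    by exists (lshift n (0 : 'I_1)).
  have [|i iE] := rowT1 (x *m pinvmx Y).
    by apply: map_f; rewrite mem_filter xe.
  have h : row (rshift 1 i) T = x by rewrite rowKd row_mul iE fsE.
  by exists (rshift 1 i).
case: es nz orth => [|e es] nz orth; last first.
  by apply: (main _ e) => //; rewrite mem_head.
have [[e ee]|h] := pselect (exists e, bil B e e != 0).
  have [|||T uT [dT _]] := main [:: e] e.
  - by rewrite mem_head.
  - by move=> x; rewrite inE => /eqP ->.
  - by move=> x y; rewrite !inE => /eqP -> /eqP ->; rewrite eqxx.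
  by exists T.
exists 1%:M; first exact: unitmx1.
split=> //; exists 0; rewrite mul1mx trmx1 mulmx1.
rewrite [B]polarization_zero ?linear0 // => x.
by apply/eqP; apply/negPn/negP => /negP xx; apply: h; exists x; apply/negP.
Qed.

(** * Isotropic vectors without zero coordinates over a finite field *)

(** The map x -> a x^2 is at most two-to-one. *)
Lemma card_scaled_squares (F : finFieldType) (a : F) :
  a != 0 -> (#|F| <= 2 * #|[set (a * x ^+ 2)%R | x in F]|)%N.
Proof.
move=> a0; set A := imset _ _; pose f x := a * x ^+ 2.
rewrite -[#|F|]sum1_card (partition_big f (mem A)) /=; last by move=> x _; apply: imset_f.
have -> : (2 * #|A| = \sum_(y in A) 2)%N by rewrite sum_nat_const mulnC.
  apply: leq_sum => _ /imsetP [x _ ->].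
rewrite sum1dep_card; apply: (@leq_trans #|[set x; - x]|); last first.
  by rewrite cards2 ltnS; case: (_ != _).
apply: subset_leq_card; apply/subsetP => y; rewrite !inE /f => /eqP.
by move/(mulfI a0)/eqP; rewrite eqf_sqr.
Qed.

(* From a solution (0, y), the line of direction (1, - s) through (0, y) gives
   the solution (2 c y s, y (a - c s^2)) / (a + c s^2). *)
Lemma conic_point (F : finFieldType) (a c d : F) :
  2 != 0 :> F -> odd #|F| -> (7 <= #|F|)%N -> a != 0 -> c != 0 -> d != 0 ->
  exists x y, [/\ x != 0, y != 0 & a * x ^+ 2 + c * y ^+ 2 = d].
Proof.
move=> F2 Fodd F7; move: a c.
have key (a c y : F) : a != 0 -> c != 0 -> d != 0 -> c * y ^+ 2 = d ->
  exists x y, [/\ x != 0, y != 0 & a * x ^+ 2 + c * y ^+ 2 = d].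
  move=> a0 c0 d0 yd.
  have y0 : y != 0 by apply: contraNneq d0 => y0; rewrite -yd y0 expr0n mulr0.
  (* The values s = 0 and c s^2 = a would give a zero coordinate, c s^2 = - a a zero denominator: at
     most 5 values are excluded. *)
  have [s] : exists s, s \notin [set 0 : F] :|: [set s | (c * s ^+ 2 == a)%R] :|: [set s | (c * s ^+ 2 == - a)%R].
    apply/existsP; rewrite -[[exists _, _]]negbK negb_exists.
    apply/negP => /forallP h.
    have two (b : F) : (#|[set s : F | (c * s ^+ 2 == b)%R]| <= 2)%N.
      have [->|[s]] := set_0Vmem [set s : F | (c * s ^+ 2 == b)%R]; first by rewrite cards0.
      rewrite inE => /eqP sb; apply: (@leq_trans #|[set s; - s]|); last first.
        by rewrite cards2 ltnS; case: (_ != _).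
      apply: subset_leq_card; apply/subsetP => t; rewrite !inE -sb => /eqP.
      by move/(mulfI c0)/eqP; rewrite eqf_sqr.
    have : (#|F| <= 5)%N.
      rewrite -cardsT.
      have -> : [set: F] = [set 0 : F] :|: [set s | (c * s ^+ 2 == a)%R] :|: [set s | (c * s ^+ 2 == - a)%R].
        by apply/setP => s; rewrite inE; have := h s; rewrite negbK => ->.
      rewrite (leq_trans (leq_card_setU _ _)) //.
      apply: (@leq_trans (3 + 2)%N) => //; apply: leq_add; last exact: two.
      rewrite (leq_trans (leq_card_setU _ _)) //.
      by apply: (@leq_trans (1 + 2)%N) => //; rewrite leq_add ?cards1.
    by move=> F5; have := leq_trans F7 F5.
  rewrite !inE !negb_or => /andP [/andP [s0 sa] sNa].
  have D0 : a + c * s ^+ 2 != 0 by rewrite addrC addr_eq0.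
  exists (2 * c * y * s / (a + c * s ^+ 2)), (y * (a - c * s ^+ 2) / (a + c * s ^+ 2)).
  split.
  - by rewrite !mulf_neq0 ?invr_eq0.
  - by rewrite !mulf_neq0 ?invr_eq0 // subr_eq0 eq_sym.
  - rewrite -yd; field; exact: D0.
move=> a c a0 c0 d0.
(* As the order of F is odd, a x^2 and d - c y^2 each take more than half of the values in F, so
   they share one. *)
pose A := [set (a * x ^+ 2)%R | x in F]; pose C := [set (c * x ^+ 2)%R | x in F].
pose C' := [set (d - z)%R | z in C].
have [z zA zC] : exists2 z, z \in A & z \in C'.
  apply/exists_inP; rewrite -[[exists (_ | _), _]]negbK negb_exists_in.
  apply/negP => /forall_inP h.
  have AC : A :&: C' = set0.
    by apply/setP => z; rewrite in_setI in_set0; apply/negP => /andP [/h /negP].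
  have := max_card [pred z in A :|: C'].
  rewrite (@eq_card _ _ (mem (A :|: C'))) // cardsU AC cards0 subn0.
  rewrite (card_imset C) ?/A; last by move=> u v /addrI /oppr_inj.
  have := card_scaled_squares a0; have := card_scaled_squares c0.
  rewrite -/A -/C -(odd_double_half #|F|) Fodd -muln2.
  by move=> h1 h2 h3; lia.
have {zA zC} [x [y]] : exists x y, a * x ^+ 2 + c * y ^+ 2 = d.
  case/imsetP: zA zC => x _ -> /imsetP [_ /imsetP [y _ ->] h].
  by exists x, y; rewrite h subrK.
have [->|x0] := eqVneq x 0.
  by rewrite expr0n mulr0 add0r; exact: key.
have [->|y0] := eqVneq y 0; last by exists x, y.
rewrite expr0n mulr0 addr0 => /key h; have [x' [y' [? ? e]]] := h c c0 a0 d0.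
by exists y', x'; rewrite addrC.
Qed.

(** The nonzero squares are not all equal, so c z^2 differs from d for some nonzero z, and
    [conic_point] applies to d - c z^2. *)
Lemma ternary_point (F : finFieldType) (a b c d : F) :
  2 != 0 :> F -> odd #|F| -> (7 <= #|F|)%N -> a != 0 -> b != 0 -> c != 0 ->
  exists x y z, [/\ x != 0, y != 0, z != 0 &
    a * x ^+ 2 + b * y ^+ 2 + c * z ^+ 2 = d].
Proof.
move=> F2 Fodd F7 a0 b0 c0.
have [z z0 zd] : exists2 z : F, z != 0 & c * z ^+ 2 != d.
  apply/exists_inP; rewrite -[[exists (_ | _), _]]negbK negb_exists_in.
  apply/negP => /forall_inP h.
  have := h 1 (oner_neq0 _); rewrite negbK expr1n mulr1 => /eqP c1.
  have [x] : exists x : F, x \notin [set 0; 1; -1].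
    apply/existsP; rewrite -[[exists _, _]]negbK negb_exists.
    apply/negP => /forallP h'.
    have : (#|F| <= 3)%N.
      rewrite -cardsT; have -> : [set: F] = [set 0; 1; -1].
        by apply/setP => s; rewrite inE; have := h' s; rewrite negbK => ->.
      rewrite (leq_trans (leq_card_setU _ _)) // cards1 addn1 ltnS.
      by rewrite cards2 ltnS; case: (_ != _).
    by move=> F3; have := leq_trans F7 F3.
  rewrite !inE !negb_or => /andP [/andP [x0 x1] xN1].
  have := h x x0; rewrite negbK -c1 -{2}[c]mulr1 -(expr1n _ 2) => /eqP /(mulfI c0) /eqP.
  by rewrite eqf_sqr (negbTE x1) (negbTE xN1).
have [|x [y [x0 y0 e]]] := @conic_point F a b (d - c * z ^+ 2) F2 Fodd F7 a0 b0.
  by rewrite subr_eq0 eq_sym.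
by exists x, y, z; split => //; rewrite e subrK.
Qed.

Lemma isotropic_completion (F : finFieldType) n (d a : 'rV[F]_n) i j k :
  2 != 0 :> F -> odd #|F| -> (7 <= #|F|)%N ->
  [/\ i != j, j != k & k != i] -> [/\ d 0 i != 0, d 0 j != 0 & d 0 k != 0] ->
  (forall l, a 0 l != 0) ->
  exists b : 'rV_n, [/\ forall l, b 0 l != 0, bil (diag_mx d) b b = 0 &
    forall l, l \notin [set i; j; k] -> b 0 l = a 0 l].
Proof.
move=> F2 Fodd F7 [ij jk ki] [di dj dk] a0.
pose s := \sum_(l | l \notin [set i; j; k]) d 0 l * (a 0 l * a 0 l).
have [x [y [z [x0 y0 z0 e]]]] := ternary_point (- s) F2 Fodd F7 di dj dk.
pose b : 'rV[F]_n := \row_l (if l == i then x else if l == j then y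
  else if l == k then z else a 0 l).
have bi : b 0 i = x by rewrite mxE eqxx.
have bj : b 0 j = y by rewrite mxE eqxx eq_sym (negbTE ij).
have bk : b 0 k = z by rewrite mxE eqxx (negbTE ki) eq_sym (negbTE jk).
have bl l : l \notin [set i; j; k] -> b 0 l = a 0 l.
  rewrite !inE !negb_or mxE => /andP [/andP [/negbTE -> /negbTE ->] /negbTE ->] //.
exists b; split => //.
  by move=> l; rewrite mxE; do ![case: ifP => // _].
rewrite bil_diag (bigD1 i) //= (bigD1 j) /=; last by rewrite eq_sym.
rewrite (bigD1 k) /=; last by rewrite ki eq_sym.
rewrite (eq_bigl (fun l => l \notin [set i; j; k])); last first.
  by move=> l; rewrite !inE !negb_or.
rewrite (eq_bigr (fun l => d 0 l * (a 0 l * a 0 l))); last first.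
  by move=> l /bl ->.
by rewrite -/s bi bj bk -!expr2 !addrA e addNr.
Qed.

(** Changing the sign of one coordinate of b keeps it isotropic without zero coordinates. If phi
    vanished on all such vectors, it would vanish on the differences, which are nonzero multiples of
    the standard basis vectors. *)
Lemma isotropic_spans (F : finFieldType) n (d : 'rV[F]_n) i j k (phi : 'cV[F]_n) :
  2 != 0 :> F -> odd #|F| -> (7 <= #|F|)%N ->
  [/\ i != j, j != k & k != i] -> [/\ d 0 i != 0, d 0 j != 0 & d 0 k != 0] ->
  phi != 0 ->
  exists b : 'rV_n, [/\ forall l, b 0 l != 0, bil (diag_mx d) b b = 0 &
    b *m phi != 0].
Proof.
move=> F2 Fodd F7 ijk dijk; apply: contraNP => h.
have [|b [b0 bb _]] := @isotropic_completion F n d (const_mx 1) i j k F2 Fodd F7 ijk dijk.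
  by move=> l; rewrite mxE oner_neq0.
have ph (c : 'rV[F]_n) : (forall l, c 0 l != 0) -> bil (diag_mx d) c c = 0 -> c *m phi = 0.
  by move=> c0 cc; apply/eqP/negPn/negP => cp; apply: h; exists c.
apply/eqP/colP => l; rewrite [RHS]mxE.
pose c : 'rV[F]_n := b - (2 * b 0 l) *: delta_mx 0 l.
have cE m : c 0 m = if m == l then - b 0 l else b 0 m.
  rewrite !mxE eqxx /=; case: eqVneq => [->|_] /=; ring.
have : c *m phi = 0.
  apply: ph => [m|]; first by rewrite cE; case: ifP => // _; rewrite oppr_eq0.
  rewrite -[RHS]bb !bil_diag; apply: eq_bigr => m _; rewrite cE.
  by case: eqP => // ->; rewrite mulrNN.
rewrite mulmxBl ph // -scalemxAl -rowE sub0r => /eqP.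
rewrite oppr_eq0 scaler_eq0 mulf_eq0 (negbTE F2) (negbTE (b0 _)) /=.
by move/eqP/matrixP/(_ 0 0); rewrite !mxE.
Qed.

(** Forgetting the coordinates i, j, k maps these vectors onto the families of n - 3 nonzero
    scalars, by [isotropic_completion]. *)
Lemma card_isotropic (F : finFieldType) n (d : 'rV[F]_n) i j k :
  2 != 0 :> F -> odd #|F| -> (7 <= #|F|)%N ->
  [/\ i != j, j != k & k != i] -> [/\ d 0 i != 0, d 0 j != 0 & d 0 k != 0] ->
  (#|F|.-1 ^ (n - 3) <=
    #|[set b : 'rV[F]_n | [forall l, b 0%R l != 0%R] && (bil (diag_mx d) b b == 0%R)]|)%N.
Proof.
move=> F2 Fodd F7 ijk dijk; set V := [set b | _].
pose D := ~: [set i; j; k].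
(* The value 0 at i, j, k makes [rho b] a function supported in D, as [card_pffun_on] counts
   them. *)
pose rho (b : 'rV[F]_n) : {ffun 'I_n -> F} := [ffun l => if l \in D then b 0 l else 0].
have cD : #|D| = (n - 3)%N.
  have [ij jk ki] := ijk; rewrite cardsCs setCK card_ord; congr (_ - _)%N.
  have kn : k \notin [set i; j] by rewrite !inE negb_or ki eq_sym.
  by rewrite setUC cardsU1 kn cards2 ij.
have cF : #|predC1 (0 : F)| = #|F|.-1 by rewrite cardC1.
rewrite -cD -cF -(card_pffun_on 0); apply: leq_trans (leq_imset_card rho V).
apply: subset_leq_card; apply/subsetP => f /pffun_onP [fD f0].
pose a : 'rV[F]_n := \row_l (if l \in D then f l else 1).
have fn0 l : l \in D -> f l != 0.
  by move=> lD; apply: (f0 (f l)); apply: image_f.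
have [|b [b0 bb ba]] := @isotropic_completion F n d a i j k F2 Fodd F7 ijk dijk.
  by move=> l; rewrite mxE; case: ifP => [/fn0//|_]; rewrite oner_neq0.
apply/imsetP; exists b; first by rewrite inE bb eqxx andbT; apply/forallP.
apply/ffunP => l; rewrite ffunE; case: ifPn => [lD|lD].
  by rewrite ba ?mxE ?lD //; rewrite inE in lD.
by apply/eqP; apply: contraNT lD => fl; apply: (subsetP fD).
Qed.

(** * Ranks and reduction modulo p *)

Lemma mxrank_sum_leq (F : fieldType) m n (I : finType) (P : {pred I})
    (A : I -> 'M[F]_(m, n)) k :
  (forall i, i \in P -> (\rank (A i) <= k)%N) ->
  (\rank (\sum_(i in P) A i)%R <= #|P| * k)%N.
Proof.
move=> h; rewrite -sum_nat_const.
elim/big_rec2: _ => [|i x B iP IH]; first by rewrite mxrank0.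
by apply: leq_trans (mxrank_add _ _) _; rewrite leq_add ?h.
Qed.

Lemma three_nonzero_entries (F : fieldType) n (d : 'rV[F]_n) :
  (3 <= \rank (diag_mx d))%N ->
  exists i j k, [/\ i != j, j != k & k != i] /\
    [/\ d 0 i != 0, d 0 j != 0 & d 0 k != 0].
Proof.
move=> h; pose S := [set l | d 0%R l != 0%R].
have dE : diag_mx d = \sum_(l in S) d 0 l *: delta_mx l l.
  rewrite diag_mx_sum_delta [RHS]big_mkcond /=; apply: eq_bigr => l _.
  by rewrite inE; case: eqP => //= ->; rewrite scale0r.
have : (3 <= #|S|)%N.
  rewrite (leq_trans h) // dE -[leqRHS]muln1; apply: mxrank_sum_leq => l _.
  by rewrite (leq_trans (mxrank_scale _ _)) // mxrank_delta.
case/card_gt2P => i [j [k [[+ + +] ijk]]]; rewrite !inE => di dj dk.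
by exists i, j, k.
Qed.

Lemma intr_Fp_eq0 (p : nat) (a : int) : prime p ->
  (a%:~R == 0 :> 'F_p) = (p %| a)%Z.
Proof.
move=> pp; have h (k : nat) : (k%:R == 0 :> 'F_p) = (p %| k)%N.
  by rewrite (dvdn_pcharf (pchar_Fp pp)).
by case: a => k; rewrite ?NegzE ?rmorphN ?oppr_eq0 /= h dvdzE ?abszN.
Qed.

Lemma two_neq0_Fp (p : nat) : prime p -> odd p -> 2 != 0 :> 'F_p.
Proof.
move=> pp po; have := intr_Fp_eq0 2%:Z pp; rewrite -[2%:~R]/(2%:R) => ->.
by rewrite dvdzE /= dvdn_prime2 //; apply: contraL po => /eqP ->.
Qed.

Lemma lift_Fp (p m n : nat) (A : 'M['F_p]_(m, n)) :
  exists B : 'M[int]_(m, n), map_mx intr B = A.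
Proof.
exists (map_mx (fun x : 'F_p => (x : nat)%:Z) A).
by apply/matrixP => i j; rewrite !mxE -[RHS]natr_Zp.
Qed.

(** * Vectors of equal norm in a positive definite lattice *)

Lemma bform_ge0 n (L : lattice n) v : positive_definite L -> 0 <= bform L v v.
Proof.
move=> Lp; have [->|v0] := eqVneq v 0; last exact: ltW (Lp v v0).
by rewrite /bform /pairing !mul0mx mxE.
Qed.

Lemma bform_eq0 n (L : lattice n) v : positive_definite L -> bform L v v = 0 -> v = 0.
Proof.
move=> Lp vv; apply/eqP/negPn/negP => v0.
by have := Lp v v0; rewrite vv ltxx.
Qed.

Lemma bformBB n (L : lattice n) u v :
  bform L (u - v) (u - v) = bform L u u + bform L v v - 2 * bform L u v.
Proof.
change (bil (gram L) (u - v) (u - v) =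
  bil (gram L) u u + bil (gram L) v v - 2 * bil (gram L) u v).
rewrite -scaleN1r !(bilDl, bilDr, bilZl, bilZr) (bilC v u (gram_trmx L)); ring.
Qed.

Lemma bformN n (L : lattice n) u v : bform L u (- v) = - bform L u v.
Proof. by rewrite -scaleN1r [LHS]bilZr mulN1r. Qed.

(** For equal norms, Cauchy-Schwarz only says that u - v and u + v have nonnegative norm. *)
Lemma bform_norm_le n (L : lattice n) (N : int) u v : positive_definite L ->
  bform L u u = N -> bform L v v = N -> `|bform L u v| <= N.
Proof.
move=> Lp uN vN; have h := bform_ge0 (u - v) Lp; have h' := bform_ge0 (u - - v) Lp.
move: h h'; rewrite !bformBB !bformN uN [bform L (- v) v](bilC _ _ (gram_trmx L)).
rewrite [bil _ v (- v)]bformN vN; lia.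
Qed.

Lemma bform_norm_eq n (L : lattice n) (N : int) u v : positive_definite L ->
  bform L u u = N -> bform L v v = N -> bform L u v = N -> u = v.
Proof.
move=> Lp uN vN uv; apply/subr0_eq/(bform_eq0 Lp); rewrite bformBB uN vN uv; lia.
Qed.

(** The product is an integer in [-1, 1], and the two ends force u = v or u = - v. *)
Lemma unit_vectors_orthogonal n (L : lattice n) u v : positive_definite L ->
  bform L u u = 1 -> bform L v v = 1 -> u <> v -> u <> - v -> bform L u v = 0.
Proof.
move=> Lp u1 v1 uv uNv.
have vN1 : bform L (- v) (- v) = 1.
  by rewrite bformN [bform L _ _](bilC _ _ (gram_trmx L)) [bil _ _ _]bformN v1 opprK.
have := bform_norm_le Lp u1 v1.
have h1 : bform L u v != 1 by apply/eqP => /(bform_norm_eq Lp u1 v1).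
have h2 : bform L u v != -1.
  by apply/eqP => h; apply: uNv; apply: (bform_norm_eq Lp u1 vN1); rewrite bformN h.
by move: h1 h2; lia.
Qed.

(** * Vectors of norm 1 modulo p and the choice of a neighbour *)

(** Vectors of norm 1 are pairwise orthogonal up to sign and keep norm 1 modulo p, so one out of
    each opposite pair can be put in an orthogonal basis. *)
Lemma reduction_basis n (L : lattice n) (p : nat) :
  prime p -> odd p -> positive_definite L ->
  exists (T : 'M['F_p]_n) d, [/\ T \in unitmx,
    T *m map_mx intr (gram L) *m T^T = diag_mx d &
    forall e, bform L e e = 1 -> exists l,
      row l T = map_mx intr e \/ row l T = - map_mx intr e].
Proof.
move=> pp po Lp; set G := map_mx intr (gram L).
have Gs : G^T = G by rewrite /G map_trmx gram_trmx.
have F2 := two_neq0_Fp pp po.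
pose P (x : 'rV['F_p]_n) := `[< exists2 e, bform L e e = 1 & map_mx intr e = x >].
have PN x : P x -> P (- x).
  move=> /asboolP [e e1 ex]; apply/asboolP; exists (- e); last by rewrite map_mxN ex.
  by rewrite bformN [bform L _ _](bilC _ _ (gram_trmx L)) [bil _ _ _]bformN opprK.
(* Out of x and - x, the one that is enumerated first. *)
pose es := [seq x <- enum {: 'rV['F_p]_n} | P x && (enum_rank x <= enum_rank (- x))%N].
have bG e e' : bil G (map_mx intr e) (map_mx intr e') = (bform L e e')%:~R.
  exact: bil_map.
have [||T uT [[d dE] Te]] := @orthogonal_basis _ n G es F2 Gs.
- by move=> x; rewrite mem_filter => /andP [/andP [/asboolP [e e1 <-] _] _]; rewrite bG e1 oner_neq0.
- move=> x y; rewrite !mem_filter => /andP [/andP [/asboolP [e e1 <-] h] _].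
  move=> /andP [/andP [/asboolP [f f1 <-] h'] _] ef.
  rewrite bG (unit_vectors_orthogonal Lp e1 f1) //.
    by move=> e_f; rewrite e_f eqxx in ef.
  move=> e_f; move: h h' ef; rewrite e_f !map_mxN opprK => h h' /eqP; apply.
  by apply: enum_rank_inj; apply: val_inj; apply/eqP; rewrite eqn_leq h h'.
exists T, d; split => // e e1.
have Pe : P (map_mx intr e) by apply/asboolP; exists e.
have [le|le] := leqP (enum_rank (map_mx intr e : 'rV['F_p]_n)) (enum_rank (- (map_mx intr e : 'rV['F_p]_n))).
  have [|l lE] := Te (map_mx intr e); last by exists l; left.
  by rewrite mem_filter Pe le mem_enum.
have [|l lE] := Te (- map_mx intr e); last by exists l; right.
by rewrite mem_filter PN // opprK ltnW // mem_enum.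
Qed.

(** The neighbour is taken at a lift v of a T. Its product with row l of T is a_l d_l, nonzero
    modulo p at the vectors of norm 1, where d_l = 1, and at row i; this excludes the first
    alternative of [neighbour], and the last hypothesis excludes the second. *)
Lemma neighbour_without_unit_vector (R : realType) m (L : lattice m.+2) (p : nat)
    (T : 'M['F_p]_m.+2) (d a : 'rV['F_p]_m.+2) i :
  prime p -> odd p ->
  T \in unitmx -> T *m map_mx intr (gram L) *m T^T = diag_mx d ->
  (forall e, bform L e e = 1 -> exists l,
      row l T = map_mx intr e \/ row l T = - map_mx intr e) ->
  d 0 i != 0 -> (forall l, a 0 l != 0) -> bil (diag_mx d) a a = 0 ->
  (forall w c, bform L w w = p%:Z * p%:Z -> c != 0 -> map_mx intr w <> c *: (a *m T)) ->
  exists2 L' : lattice m.+2, same_genus R L L' &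
    forall y, bform L' y y <> 1.
Proof.
move=> pp po uT dE Te di a0 aa short.
have [v vE] := lift_Fp (a *m T).
have [u uE] := lift_Fp (row i T).
have bG x y : bil (map_mx intr (gram L)) (map_mx intr x) (map_mx intr y) = (bform L x y)%:~R :> 'F_p.
  exact: bil_map.
have rT l : bil (map_mx intr (gram L)) (a *m T) (row l T) = a 0 l * d 0 l.
  by rewrite rowE bil_mulmx dE /bil trmx_delta -colE mul_mx_diag !mxE.
have [||L' gL' hL'] := @neighbour R m L p v u pp po.
- by rewrite -intr_Fp_eq0 // -bG vE bil_mulmx dE aa.
- by rewrite -intr_Fp_eq0 // -bG vE uE rT mulf_neq0.
exists L' => // y /hL' [[x x1]|[j [z [pj /= ww]]]].
  rewrite -intr_Fp_eq0 // -bG (bilC _ _ (_ : _^T = _)); last by rewrite map_trmx gram_trmx.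
  have [l] := Te x x1.
  have dl : row l T = map_mx intr x \/ row l T = - map_mx intr x -> d 0 l = 1.
    have -> : d 0 l = bil (map_mx intr (gram L)) (row l T) (row l T).
      by rewrite -gramE dE mxE eqxx.
    by case=> ->; rewrite -?scaleN1r ?bilZl ?bilZr bG x1 ?mulN1r ?opprK.
  move=> h; have d1 := dl h; have := rT l.
  rewrite vE d1 mulr1; case: h => -> h.
    by rewrite h (negbTE (a0 l)).
  by move: h; rewrite -scaleN1r bilZr => h; rewrite -oppr_eq0 -mulN1r h (negbTE (a0 l)).
apply: (short _ (j%:~R) ww); first by rewrite intr_Fp_eq0.
rewrite map_mxD !map_mxZ /= vE.
have -> : p%:~R = 0 :> 'F_p by apply/eqP; rewrite intr_Fp_eq0 // dvdzz.
by rewrite scale0r addr0.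
Qed.

(** * Counting vectors of given norm by ranks of entrywise products *)

(** P Q is a sum of n matrices of rank at most 1, and an entrywise product with one of these is a
    product with diagonal matrices on both sides. *)
Lemma mxrank_hadamard_mul (F : fieldType) k m n (M : 'M[F]_(k, m)) (P : 'M_(k, n)) (Q : 'M_(n, m)) :
  (\rank (\matrix_(i, j) (M i j * (P *m Q) i j))%R <= n * \rank M)%N.
Proof.
have -> : \matrix_(i, j) (M i j * (P *m Q) i j) =
    \sum_(l in 'I_n) diag_mx (col l P)^T *m M *m diag_mx (row l Q).
  apply/matrixP => i j; rewrite summxE mxE [(P *m Q) i j]mxE mulr_sumr.
  apply: eq_bigr => l _; rewrite mul_mx_diag mul_diag_mx !mxE; ring.
rewrite -[X in (X * _)%N]card_ord; apply: mxrank_sum_leq => l _.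
by rewrite (leq_trans (mxrankM_maxl _ _)) // mxrankM_maxr.
Qed.

(** Each factor multiplies the rank by at most n + 1: n for P Q and 1 for the constant c. The empty
    product is the all-ones matrix. *)
Lemma mxrank_prod_shift (F : fieldType) k n (P : 'M[F]_(k, n)) (Q : 'M_(n, k)) (cs : seq F) :
  (\rank (\matrix_(i, j) (\prod_(c <- cs) ((P *m Q) i j - c)))%R <= n.+1 ^ size cs)%N.
Proof.
elim: cs => [|c cs IH] /=.
  rewrite expn0; have -> : \matrix_(i, j) (\prod_(c <- [::]) ((P *m Q) i j - c)) =
      const_mx 1 *m (const_mx 1 : 'M[F]_(1, k)).
    by apply/matrixP => i j; rewrite !mxE big_nil big_ord1 !mxE mulr1.
  by rewrite (leq_trans (mxrankM_maxl _ _)) // rank_leq_col.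
pose M : 'M[F]_k := \matrix_(i, j) (\prod_(c <- cs) ((P *m Q) i j - c)).
have -> : \matrix_(i, j) (\prod_(c <- c :: cs) ((P *m Q) i j - c)) =
    \matrix_(i, j) (M i j * (P *m Q) i j) + (- c) *: M.
  by apply/matrixP => i j; rewrite !mxE big_cons; ring.
rewrite (leq_trans (mxrank_add _ _)) // expnS mulSn addnC leq_add //.
  by rewrite (leq_trans (mxrank_scale _ _)).
by rewrite (leq_trans (mxrank_hadamard_mul _ _ _)) // leq_mul2l IH orbT.
Qed.

(* Off the diagonal, the Gram matrix of distinct vectors of norm N has entries
   in [-N, N), so the entrywise product of its shifts by -N, ..., N - 1 is an
   invertible diagonal matrix, of rank bounded by mxrank_prod_shift. *)
Lemma card_norm_vectors n (L : lattice n) (N : nat) (s : seq 'rV[int]_n) :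
  positive_definite L -> uniq s -> {in s, forall w, bform L w w = N} ->
  (size s <= n.+1 ^ (2 * N))%N.
Proof.
move=> Lp us sN; set k := size s.
pose X : 'M[int]_(k, n) := \matrix_i nth 0 s i.
pose f : int -> rat := intr.
pose P := map_mx f X; pose Q := map_mx f (gram L *m X^T).
have PQ i j : (P *m Q) i j = f (bform L (nth 0 s i) (nth 0 s j)).
  by rewrite -map_mxM mxE mulmxA gramE !rowK.
pose cs := [seq f (c%:Z - N%:Z) | c <- iota 0 (2 * N)].
have := mxrank_prod_shift P Q cs.
rewrite size_map size_iota; set A := (X in \rank X).
have nthN (i : 'I_k) : bform L (nth 0 s i) (nth 0 s i) = N by rewrite sN ?mem_nth.
have Adiag : A = diag_mx (\row_i (A i i)).
  apply/matrixP => i j; rewrite [RHS]mxE; have [->|ij] := eqVneq i j.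
    by rewrite mulr1n [RHS]mxE.
  rewrite mulr0n mxE PQ; set b := bform L _ _.
  have bN : `|b| <= N%:Z by apply: bform_norm_le.
  have bneN : b != N%:Z.
    apply: contra ij => /eqP /(bform_norm_eq Lp (nthN i) (nthN j)) /eqP.
    by rewrite nth_uniq.
  apply/eqP; rewrite prodf_seq_eq0; apply/hasP; exists (f b); last by rewrite subrr eqxx.
  apply/mapP; exists (absz (b + N%:Z)); first by rewrite mem_iota; lia.
  by congr f; lia.
rewrite mxrank_unit // Adiag unitmxE det_diag unitfE; apply/prodf_neq0 => i _.
rewrite [X in X != 0]mxE /A mxE prodf_seq_neq0; apply/allP => _ /mapP [c + ->]; rewrite mem_iota => cN /=.
by rewrite PQ nthN -rmorphB /= intr_eq0; lia.
Qed.

(** Otherwise lists of distinct vectors of norm N could be prolonged forever, against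
    [card_norm_vectors]. *)
Lemma norm_vectors_enum n (L : lattice n) (N : nat) : positive_definite L ->
  exists2 s : seq 'rV[int]_n, uniq s & forall w, (w \in s) = (bform L w w == N).
Proof.
move=> Lp; apply: contrapT => h.
suff [s [us sN sz]] : exists s : seq 'rV[int]_n, [/\ uniq s, {in s, forall w, bform L w w = N} &
    size s = (n.+1 ^ (2 * N)).+1].
  by have := card_norm_vectors Lp us sN; rewrite sz ltnn.
elim: (_ ^ _)%N.+1 => [|k [s [us sN sz]]]; first by exists [::].
have [w wN ws] : exists2 w, bform L w w = N & w \notin s.
  apply: contrapT => h'; apply: h; exists s => // w; apply/idP/eqP; first exact: sN.
  by move=> wN; apply/negPn/negP => ws; apply: h'; exists w.
exists (w :: s); split; rewrite /= ?us ?ws ?sz //.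
by move=> x; rewrite inE => /orP [/eqP ->|/sN].
Qed.

(** * The two constructions of a neighbour without vectors of norm 1 *)

(** In the Smith normal form X = A D B, a zero column j of D makes X kill column j of the inverse of
    B, which is nonzero modulo p. Without zero columns, D has full column rank over the
    rationals. *)
Lemma hyperplane_or_full (p k n : nat) (X : 'M[int]_(k, n)) : prime p ->
  (exists2 phi : 'cV['F_p]_n, phi != 0 & map_mx intr X *m phi = 0) \/
  row_full (map_mx intr X : 'M[rat]_(k, n)).
Proof.
move=> pp; have [A uA [B uB [d _ XE]]] := int_Smith_normal_form X.
set D := \matrix_(_, _) _ in XE.
have uB' (F : comUnitRingType) : map_mx intr B \in @unitmx F n.
  by rewrite unitmxE det_map_mx rmorph_unit // -unitmxE.
have uA' (F : comUnitRingType) : map_mx intr A \in @unitmx F k.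
  by rewrite unitmxE det_map_mx rmorph_unit // -unitmxE.
have [[j Dj]|h] := pselect (exists j, col j D = 0); [left|right].
  exists (map_mx intr (col j (invmx B))).
    apply/eqP => h; have : map_mx intr (B *m col j (invmx B)) = 0 :> 'cV['F_p]_n.
      by rewrite map_mxM h mulmx0.
    rewrite colE mulmxA mulmxV // mul1mx => /matrixP /(_ j 0).
    by rewrite !mxE !eqxx => /eqP; rewrite oner_eq0.
  rewrite -map_mxM XE colE !mulmxA mulmxK // -mulmxA -colE Dj mulmx0.
  by apply/matrixP => i l; rewrite !mxE.
rewrite /row_full XE !map_mxM mxrankMfree; last by rewrite row_free_unit; exact: uB'.
rewrite eqmxMfull; last by rewrite row_full_unit; exact: uA'.
change (row_full (map_mx intr D : 'M[rat]_(k, n))).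
rewrite -sub1mx; apply/row_subP => j; rewrite rowE mulmx1.
have [i Dij] : exists i, D i j != 0.
  apply: contrapT => h'; apply: h; exists j; apply/colP => i; rewrite !mxE.
  by apply/eqP/negPn/negP => Dij; apply: h'; exists i; rewrite mxE.
have ij : (i == j :> nat) by move: Dij; rewrite mxE; case: (nat_of_ord i == j) => //; rewrite mulr0n eqxx.
have -> : delta_mx 0 j = ((D i j)%:~R)^-1 *: row i (map_mx intr D) :> 'rV[rat]_n.
  apply/rowP => l; rewrite !mxE eqxx /= ij mulr1n.
  rewrite (eqP ij) -[(j == l :> nat)]/(j == l) eq_sym.
  case: eqP => _; last by rewrite mulr0n mulr0.
  rewrite mulr1n mulVf // intr_eq0.
  by move: Dij; rewrite mxE ij (eqP ij) mulr1n.
by rewrite scalemx_sub // row_sub.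
Qed.

Lemma mxrank_congr (F : fieldType) n (T G : 'M[F]_n) : T \in unitmx ->
  \rank (T *m G *m T^T) = \rank G.
Proof.
move=> uT; rewrite mxrankMfree; last by rewrite row_free_unit unitmx_tr.
by rewrite eqmxMfull // row_full_unit.
Qed.

Lemma prime_ge7_odd p : prime p -> (7 <= p)%N -> odd p.
Proof. by move=> pp; case: (even_prime pp) => // ->. Qed.

(** [isotropic_spans] provides an isotropic vector off the hyperplane phi = 0, which contains the
    reductions of all vectors of norm p^2. *)
Lemma hyperplane_neighbour (R : realType) m (L : lattice m.+2) (p : nat)
    (phi : 'cV['F_p]_m.+2) :
  prime p -> (7 <= p)%N -> positive_definite L ->
  (3 <= \rank (map_mx intr (gram L) : 'M['F_p]_m.+2))%N -> phi != 0 ->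
  (forall w, bform L w w = p%:Z * p%:Z -> map_mx intr w *m phi = 0) ->
  exists2 L' : lattice m.+2, same_genus R L L' & forall y, bform L' y y <> 1.
Proof.
move=> pp p7 Lp rk phi0 wphi; have po := prime_ge7_odd pp p7.
have F2 := two_neq0_Fp pp po.
have [T [d [uT dE Te]]] := reduction_basis pp po Lp.
have [|i [j [k [ijk dijk]]]] := @three_nonzero_entries _ _ d.
  by rewrite -dE mxrank_congr.
have phi1 : T *m phi != 0.
  by apply: contraNneq phi0 => h; rewrite -(mulKmx uT phi) h mulmx0.
have Fp : #|'F_p| = p by exact: card_Fp.
have [||a [a0 aa ap]] := @isotropic_spans _ _ d i j k (T *m phi) F2 _ _ ijk dijk phi1.
- by rewrite Fp.
- by rewrite Fp.
have [di _ _] := dijk.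
apply: (neighbour_without_unit_vector R pp po uT dE Te di a0 aa) => w c wp c0 wE.
have := wphi w wp; rewrite wE -scalemxAl -mulmxA => /eqP.
by rewrite scaler_eq0 (negbTE c0) (negbTE ap).
Qed.

(** The inequality compares an upper bound for the number of scalar multiples of reductions of
    vectors of norm p^2 with a lower bound for the number of isotropic vectors without zero
    coordinates. *)
Lemma many_isotropic_neighbour (R : realType) m (L : lattice m.+2) (p : nat) :
  prime p -> (7 <= p)%N -> positive_definite L ->
  (3 <= \rank (map_mx intr (gram L) : 'M['F_p]_m.+2))%N ->
  (p * m.+3 ^ (2 * (p * p)) < p.-1 ^ (m.+2 - 3))%N ->
  exists2 L' : lattice m.+2, same_genus R L L' & forall y, bform L' y y <> 1.
Proof.
move=> pp p7 Lp rk big; have po := prime_ge7_odd pp p7.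
have F2 := two_neq0_Fp pp po.
have [T [d [uT dE Te]]] := reduction_basis pp po Lp.
have [|i [j [k [ijk dijk]]]] := @three_nonzero_entries _ _ d.
  by rewrite -dE mxrank_congr.
have Fp : #|'F_p| = p by exact: card_Fp.
have Fodd : odd #|'F_p| by rewrite Fp.
have F7 : (7 <= #|'F_p|)%N by rewrite Fp.
have [s us sE] := norm_vectors_enum (p * p) Lp.
have s_le : (size s <= m.+3 ^ (2 * (p * p)))%N.
  by apply: (card_norm_vectors Lp us) => w; rewrite sE => /eqP.
have := card_isotropic F2 Fodd F7 ijk dijk; set V := [set b | _] => cV.
pose W : seq 'rV['F_p]_m.+2 :=
  [seq c *: (map_mx intr w *m invmx T) | c <- enum 'F_p, w <- s].
have sW : (size W <= p * m.+3 ^ (2 * (p * p)))%N.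
  by rewrite size_allpairs -cardE Fp leq_mul2l s_le orbT.
have [a aV aW] : exists2 a, a \in V & a \notin W.
  apply/exists_inP; rewrite -[[exists (_ | _), _]]negbK negb_exists_in.
  apply/negP => /forall_inP h.
  have : (#|V| <= #|W|)%N.
    by apply: subset_leq_card; apply/subsetP => a /h; rewrite negbK.
  move/leq_trans => /(_ _ (card_size W)) /leq_trans => /(_ _ sW).
  by rewrite leqNgt (leq_trans big) // -[in leqLHS]Fp.
move: aV; rewrite inE => /andP [/forallP a0 /eqP aa].
have [di _ _] := dijk.
apply: (neighbour_without_unit_vector R pp po uT dE Te di a0 aa) => w c wp c0 wE.
case/negP: aW; apply/allpairsP; exists (c^-1, w) => /=; split.
- by rewrite mem_enum.
- by rewrite sE wp PoszM.
- by rewrite wE -scalemxAl mulmxK // scalerA mulVf // scale1r.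
Qed.

(** * Gram determinants and the primes of small rank *)

Lemma norm_det_le n (A : 'M[int]_n) (B : int) : (forall i j, `|A i j| <= B) ->
  `|\det A| <= n`!%:R * B ^+ n.
Proof.
move=> AB; rewrite (le_trans (ler_norm_sum _ _ _)) //.
rewrite -card_Sn mulr_natl -sumr_const.
under [leRHS]eq_bigl do rewrite inE.
apply: ler_sum => s _.
rewrite normrM normrX normrN1 expr1n mul1r normr_prod.
rewrite -[n in leRHS](card_ord n) -prodr_const.
by apply: ler_prod => i _; rewrite normr_ge0 AB.
Qed.

Lemma prod_primes_dvdn (a b N : nat) :
  (forall q, prime q -> (a <= q < b)%N -> (q %| N)%N) ->
  (\prod_(a <= q < b | prime q) q %| N)%N.
Proof.
elim: b => [|b IH] h; first by rewrite big_geq // dvd1n.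
have [ab|ba] := leqP a b; last by rewrite big_geq // dvd1n.
have IH' : (\prod_(a <= q < b | prime q) q %| N)%N.
  by apply: IH => q pq /andP [aq qb]; apply: h => //; rewrite aq ltnW.
rewrite big_mkcond big_nat_recr //= -big_mkcond /=.
case: ifP => pb; last by rewrite muln1.
rewrite Gauss_dvd ?IH' ?h ?ab ?ltnSn //.
rewrite coprime_sym prime_coprime // Euclid_dvd_prod // big_has_cond.
apply/negP => /hasP [q]; rewrite mem_index_iota => /andP [_ qb] /andP [pq].
by rewrite dvdn_prime2 // => /eqP bq; rewrite bq ltnn in qb.
Qed.

(** Modulo p this k x k matrix has at most the rank of G, so it is singular. *)
Lemma dvd_det_gram (p n k : nat) (G : 'M[int]_n) (Y : 'M[int]_(k, n)) : prime p ->
  (\rank (map_mx intr G : 'M['F_p]_n) < k)%N ->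
  (p %| \det (Y *m G *m Y^T)%R)%Z.
Proof.
move=> pp rk; rewrite -intr_Fp_eq0 // -det_map_mx /= !map_mxM.
apply/eqP; apply: contraTeq rk; rewrite -unitfE -unitmxE => /mxrank_unit rk.
rewrite -leqNgt -[leqLHS]rk.
by rewrite (leq_trans (mxrankM_maxl _ _)) // mxrankM_maxr.
Qed.

Lemma det_gram_neq0 n k (L : lattice n) (Y : 'M[int]_(k, n)) :
  positive_definite L -> (forall y : 'rV_k, y *m Y = 0 -> y = 0) ->
  \det (Y *m gram L *m Y^T) != 0.
Proof.
move=> Lp Yfree; apply/det0P => - [y y0 yE].
case/negP: y0; apply/eqP/Yfree/(bform_eq0 Lp).
change (bil (gram L) (y *m Y) (y *m Y) = 0).
by rewrite bil_mulmx /bil yE mul0mx mxE.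
Qed.

(** The bound is 3! (p^2)^3, from the Leibniz formula for the Gram determinant of three independent
    vectors of norm p^2. *)
Lemma bad_primes_bound n (L : lattice n) (p K : nat) (s : seq 'rV[int]_n) :
  positive_definite L -> (3 <= n)%N ->
  {in s, forall w, bform L w w = p%:Z * p%:Z} ->
  row_full (map_mx intr (\matrix_(i < size s) nth 0 s i) : 'M[rat]_(size s, n)) ->
  (forall q, prime q -> (K <= q < p)%N ->
    (\rank (map_mx intr (gram L) : 'M['F_q]_n) < 3)%N) ->
  (\prod_(K <= q < p | prime q) q <= 6 * p ^ 6)%N.
Proof.
move=> Lp n3 sN full bad; set X := \matrix_(_ < _) _ in full.
(* f selects n independent rows of X, and Y consists of the first three of them. *)
pose f := fullrankfun full.
pose A := rowsub f X; pose Y : 'M[int]_(3, n) := rowsub (widen_ord n3) A.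
have detX : \det A != 0.
  have := fullrowsub_unit full; rewrite -/f unitmxE unitfE.
  by rewrite -map_mxsub det_map_mx intr_eq0.
have Yfree (y : 'rV_3) : y *m Y = 0 -> y = 0.
  rewrite /Y rowsubE mulmxA; set z := y *m _ => zX.
  have z0 : z = 0.
    by apply/eqP; apply: contraNT detX => z0; apply/det0P; exists z.
  apply/rowP => i; have /rowP /(_ (widen_ord n3 i)) := z0.
  rewrite !mxE (bigD1 i) //= big1 => [|k ki].
    by rewrite !mxE eqxx mulr1 addr0.
  rewrite !mxE -[_ == _]/(k == i) (negbTE ki) mulr0 //.
have G0 := det_gram_neq0 Lp Yfree; set D := \det _ in G0.
have Drow i : row i Y \in s by rewrite row_rowsub row_rowsub rowK mem_nth.
have D_le : `|D| <= 3`!%:R * (p%:Z * p%:Z) ^+ 3.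
  apply: norm_det_le => i j; rewrite gramE.
  by apply: (bform_norm_le Lp); apply: sN.
have : (\prod_(K <= q < p | prime q) q %| `|D|)%N.
  by apply: prod_primes_dvdn => q pq Kqp; apply: dvd_det_gram => //; apply: bad.
move/dvdn_leq; rewrite absz_gt0 G0 => /(_ isT) h; apply: (leq_trans h).
have e : (p%:Z * p%:Z) ^+ 3 = (p ^ 6)%N.
  by rewrite -PoszM -[Posz _]natz -natrX natz mulnn -expnM.
by move: D_le; rewrite e -lez_nat PoszM abszE natz.
Qed.

(** * Growth of products of primes and of exponentials *)

(* Erdos: x > 0 is determined by its squarefree part, a product of distinct
   primes, and the largest square dividing it. *)
Lemma prime_count_ge j : (j <= \sum_(0 <= q < 4 ^ j | prime q) 1)%N.
Proof.
case: j => // j; set J := j.+1.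
have [M ME] : exists M, (4 ^ J = M.+1)%N by exists (4 ^ J).-1; rewrite prednK // expn_gt0.
have M2 : (M.+1 = 2 ^ J * 2 ^ J)%N by rewrite -ME -expnMn.
pose A (x : nat) : {set 'I_M.+1} := [set q : 'I_M.+1 | prime q & odd (logn q x)].
pose b (x : nat) := (\prod_(q < M.+1 | prime q) q ^ (logn q x)./2)%N.
have bA (x : 'I_M.+1) : (0 < x)%N -> (x = \prod_(q in A x) q * (b x * b x) :> nat)%N.
  move=> x0; rewrite -[LHS](partnT x0) (@widen_partn M); last by rewrite -ltnS.
  rewrite /b -big_split /= big_mkord [in RHS]big_mkcond [in X in (_ * X)%N]big_mkcond.
  rewrite -big_split /=.
  apply: eq_bigr => q _; rewrite inE.
  have [pq|npq] := boolP (prime q); last by rewrite lognE (negbTE npq).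
  rewrite -{1}[logn q x]odd_double_half expnD -addnn expnD /=.
  by case: (odd _); rewrite ?expn1 ?expn0.
have b_lt (x : 'I_M.+1) : (0 < x)%N -> (b x < 2 ^ J)%N.
  move=> x0; rewrite ltnNge; apply/negP => h.
  have := ltn_ord x; rewrite ltnNge => /negP; apply.
  rewrite [leqRHS](bA x x0) [leqLHS]M2 -[leqLHS]mul1n leq_mul ?leq_mul //.
  by rewrite lt0n; apply: contraTneq (x0) => z; rewrite (bA x x0) z.
pose S := [set q : 'I_M.+1 | prime q].
have J0 : (0 < 2 ^ J)%N by rewrite expn_gt0.
pose g (x : 'I_M.+1) := (A x, inord (b x) : 'I_(2 ^ J).-1.+1).
have ginj : {in [set~ ord0] &, injective g}.
  move=> x y; rewrite !inE -!(inj_eq val_inj) /= -!lt0n => x0 y0 [Axy bxy].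
  apply: val_inj; rewrite /= (bA x x0) (bA y y0) Axy.
  have /(congr1 (@nat_of_ord _)) := bxy.
  by rewrite !inordK ?prednK ?b_lt // => ->.
have sub : g @: [set~ ord0] \subset setX (powerset S) [set: 'I_(2 ^ J).-1.+1].
  apply/subsetP => _ /imsetP [x _ ->]; rewrite !inE andbT.
  by apply/subsetP => q; rewrite !inE => /andP [].
have := subset_leq_card sub; rewrite card_in_imset // cardsX card_powerset cardsT card_ord.
rewrite prednK // cardsC1 card_ord /=.
have -> : (\sum_(0 <= q < 4 ^ J | prime q) 1 = #|S|)%N.
  by rewrite ME big_mkord sum1dep_card.
(* Injectivity gives M <= 2^(c + J). If c < J, then 2^(c + J + 1) <= M + 1, which is impossible as
   2^(c + J) > 1. *)
rewrite -expnD; move: #|S| => c h; rewrite -(leq_add2r J) leqNgt; apply/negP => lt.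
have : (2 ^ (c + J).+1 <= M.+1)%N by rewrite M2 -expnD leq_exp2l.
have : (1 < 2 ^ (c + J))%N by rewrite -{1}(expn0 2) ltn_exp2l // addnS.
by rewrite expnS; lia.
Qed.

(** Let j be the integral part of log_4 p. At least j - K primes lie in [K, p), so their product is
    at least K^(j - K) = 4^(12 (j - K)); for j >= 2 K + 2 this is at least 4^(6 j + 8), which
    exceeds 6 p^6. *)
Lemma primorial_large :
  exists K P1, (7 <= K)%N /\
    forall p, (P1 <= p)%N -> (6 * p ^ 6 < \prod_(K <= q < p | prime q) q)%N.
Proof.
(* The equation keeps 4^12 from being computed in unary. *)
have [K KE] : exists K, (K = 4 ^ 12)%N by exists (4 ^ 12)%N.
have K7 : (7 <= K)%N by rewrite KE (@leq_trans (4 ^ 2)%N) // leq_exp2l.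
exists K, (4 ^ (2 * K + 2))%N; split => // p Pp.
have p0 : (0 < p)%N by apply: leq_trans Pp; rewrite expn_gt0.
have /andP [pj jp] := trunc_log_bounds (isT : (1 < 4)%N) p0.
have := trunc_log_max (isT : (1 < 4)%N) Pp; set j := trunc_log 4 p in pj jp * => Kj.
have KP : (K <= p)%N.
  apply: leq_trans Pp; apply: leq_trans (_ : 2 * K + 2 <= _)%N; first by lia.
  by apply: ltnW; apply: ltn_expl.
pose c := (\sum_(K <= q < p | prime q) 1)%N.
have cj : (j - K <= c)%N.
  have h1 : (j <= \sum_(0 <= q < p | prime q) 1)%N.
    apply: leq_trans (prime_count_ge j) _.
    by rewrite [leqRHS](big_cat_nat _ pj) //= leq_addr.
  have h2 : (\sum_(0 <= q < K | prime q) 1 <= K)%N.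
    rewrite big_mkcond /=; apply: leq_trans (_ : \sum_(0 <= q < K) 1 <= _)%N.
      by apply: leq_sum => q _; case: ifP.
    by rewrite sum_nat_const_nat subn0 muln1.
  move: h1; rewrite (big_cat_nat _ KP) //= -/c; lia.
have prod_ge : (K ^ c <= \prod_(K <= q < p | prime q) q)%N.
  rewrite /c big_nat_cond [leqRHS]big_nat_cond.
  elim/big_rec2: _ => [|q x y /andP [/andP [Kq _] _] IH]; first by rewrite expn0.
  by rewrite add1n expnS leq_mul.
apply: leq_trans prod_ge.
have : (6 * p ^ 6 < 4 ^ 2 * (4 ^ j.+1) ^ 6)%N.
  apply: leq_ltn_trans (_ : 4 ^ 2 * p ^ 6 < _)%N; first by rewrite leq_mul2r orbT.
  by rewrite ltn_pmul2l // ltn_exp2r.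
move/leq_trans; apply; rewrite KE -!expnM -expnD leq_exp2l //; lia.
Qed.

(** With m the quotient of n by 2 D, n + 1 <= 2 D (m + 1) and m + 1 <= 2^m bound the left-hand side
    by C 2^(m D), where m D is at most n / 2. *)
Lemma exp_dominates_poly c D : (0 < D)%N ->
  exists N, forall n, (N <= n)%N -> (c * n.+1 ^ D < 2 ^ (n - 3))%N.
Proof.
move=> D0; pose C := (c * (2 * D) ^ D)%N.
exists (2 * (C + 3))%N => n Cn.
pose m := (n %/ (2 * D))%N.
have nm : (n.+1 <= 2 * D * m.+1)%N.
  by rewrite /m mulnC ltn_ceil // muln_gt0.
have mn : (m * (2 * D) <= n)%N by exact: leq_trunc_div.
apply: leq_ltn_trans (_ : c * ((2 * D) ^ D * 2 ^ (m * D)) < _)%N.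
  rewrite leq_mul2l; apply/orP; right.
  apply: leq_trans (_ : (2 * D * m.+1) ^ D <= _)%N; first by rewrite leq_exp2r.
  by rewrite expnMn expnM leq_mul2l leq_exp2r // ltn_expl // orbT.
rewrite mulnA -/C.
apply: leq_trans (_ : 2 ^ C * 2 ^ (m * D) <= _)%N.
  by rewrite ltn_pmul2r ?expn_gt0 // ltn_expl.
by rewrite -expnD leq_exp2l //; lia.
Qed.

(** * Bounds for genera whose lattices all have a vector of norm 1 *)

(** Modulo a prime above K + |det L| the form stays nondegenerate. *)
Lemma good_prime n (L : lattice n) K : (3 <= n)%N ->
  exists2 p, prime p & (K <= p)%N &&
    (3 <= \rank (map_mx intr (gram L) : 'M['F_p]_n))%N.
Proof.
move=> n3; have [p pK pp] := prime_above (K + `|\det (gram L)|)%N.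
exists p => //; rewrite (leq_trans _ (ltnW pK)) ?leq_addr //=.
rewrite mxrank_unit // unitmxE det_map_mx unitfE /= intr_Fp_eq0 //.
apply/negP => /dvdn_leq; rewrite absz_gt0 gram_det => /(_ isT).
by rewrite leqNgt (leq_ltn_trans _ pK) ?leq_addl.
Qed.

Lemma unit_vector_genus_bounds : exists P N, forall (R : realType) n (L : lattice n),
  (3 <= n)%N -> positive_definite L ->
  (forall L', same_genus R L L' -> exists v, bform L' v v = 1) ->
  (n < N)%N /\ exists (p : nat) (X : 'M[int]_n), [/\ (p < P)%N, \det X != 0 &
    forall i, bform L (row i X) (row i X) = p%:Z * p%:Z].
Proof.
have [K [P [K7 KP]]] := primorial_large.
(* [card_norm_vectors] has exponent 2 p^2 < 2 P^2; the successor makes the degree visibly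
   positive. *)
have [N NP] := @exp_dominates_poly P (2 * (P * P)).+1 isT.
exists P, N => R n L n3 Lp unitL.
case: n L n3 Lp unitL => [|[|m]] // L n3 Lp unitL.
have Lno : ~ (exists2 L' : lattice m.+2, same_genus R L L' & forall y, bform L' y y <> 1).
  by move=> [L' /unitL [v v1] /(_ v)].
pose good p := [&& prime p, (K <= p)%N & (3 <= \rank (map_mx intr (gram L) : 'M['F_p]_m.+2))%N].
have gex : exists p, good p.
  by have [p pp h] := good_prime L K n3; exists p; rewrite /good pp h.
case: (ex_minnP gex) => p /and3P [pp Kp rkp] pmin.
have p7 : (7 <= p)%N by exact: leq_trans Kp.
have [s us sE] := norm_vectors_enum (p * p) Lp.
have sN w : (w \in s) = (bform L w w == p%:Z * p%:Z) by rewrite sE PoszM.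
pose X : 'M[int]_(size s, m.+2) := \matrix_(i < size s) nth 0 s i.
have full : row_full (map_mx intr X : 'M[rat]_(size s, m.+2)).
  have [[phi phi0 Xphi]|//] := hyperplane_or_full X pp.
  case: Lno; apply: (hyperplane_neighbour R pp p7 Lp rkp phi0) => w /eqP.
  rewrite -sN -index_mem => ws; pose i := Ordinal ws.
  have -> : w = row i X by rewrite rowK nth_index // -index_mem.
  by rewrite map_row -row_mul Xphi; apply/rowP => j; rewrite !mxE.
(* By minimality of p, the form has rank less than 3 modulo every prime of [K, p); for p >= P their
   product would exceed 6 p^6. *)
have pP : (p < P)%N.
  rewrite ltnNge; apply/negP => /KP; apply/negP; rewrite -leqNgt.
  apply: (bad_primes_bound Lp n3 _ full) => [w|q pq /andP [Kq qp]].
    by rewrite sN => /eqP.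
  rewrite ltnNge; apply/negP => rkq.
  by have := pmin q; rewrite /good pq Kq rkq => /(_ isT); rewrite leqNgt qp.
split.
  rewrite ltnNge; apply/negP => /NP big; apply: Lno.
  apply: (many_isotropic_neighbour R pp p7 Lp rkp).
  apply: leq_ltn_trans (_ : P * m.+3 ^ (2 * (P * P)).+1 < _)%N.
    rewrite leq_mul ?(ltnW pP) // leq_pexp2l // ltnW // ltnS leq_mul2l.
    by rewrite leq_mul ?(ltnW pP).
  apply: leq_trans big _; case: (m.+2 - 3)%N => // k.
  by rewrite leq_exp2r // -ltnS prednK ?(leq_trans _ p7).
exists p, (rowsub (fullrankfun full) X); split => //.
  have := fullrowsub_unit full; rewrite unitmxE unitfE.
  by rewrite -map_mxsub det_map_mx intr_eq0.
move=> i; rewrite row_rowsub rowK; apply/eqP; rewrite -sN mem_nth //.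
Qed.

(** * Computability of finite tables *)

(** Induction on the length of the table: a primitive recursion starts at t(0) and, ignoring the
    previous value, calls at i the program of the shifted table. *)
Lemma eventually_zero_computable N (t : nat -> nat) :
  (forall n, (N <= n)%N -> t n = 0%N) ->
  exists P : murec 1, forall n, computes P [tuple n] (t n).
Proof.
have cst c : exists P : murec 0, forall v, computes P v c.
  elim: c => [|c [P hP]]; first by exists (MuZero 0).
  exists (MuComp MuSucc (fun _ : 'I_1 => P)) => v /=.
  by exists [tuple c]; split => // i; rewrite (tnth_nth 0%N) (ord1 i).
elim: N t => [|N IH] t t0.
  by exists (MuZero 1) => n /=; apply: t0.
have [P hP] := IH (fun n => t n.+1) (fun n h => t0 n.+1 h).
have [Q hQ] := cst (t 0%N).
exists (MuPrec Q (MuComp P (fun _ : 'I_1 => MuProj (0 : 'I_2)))) => n /=.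
exists t; split => //.
move=> i _; exists [tuple i]; split => // j.
by rewrite !(tnth_nth 0%N) (ord1 j).
Qed.

(** * Finiteness of the set of genera *)

(* The rows of X span a sublattice of index D = det X with basis x, and the
   lattice is spanned by the combinations of x / D with coefficients adj X;
   since it contains x, only adj X modulo D matters. *)
Lemma same_genus_of_sublattice (R : realType) n (L L' : lattice n) (X X' : 'M[int]_n) :
  \det X = \det X' -> \det X != 0 ->
  X *m gram L *m X^T = X' *m gram L' *m X'^T ->
  (forall i j, (\adj X i j = \adj X' i j %[mod \det X])%Z) ->
  same_genus R L L'.
Proof.
move=> dX dX0 GX YX; set D := \det X in dX0 YX.
set Y := \adj X in YX; set Y' := \adj X' in YX.
have YXE : Y *m X = D%:M by exact: mul_adj_mx.
have YXE' : Y' *m X' = D%:M by rewrite mul_adj_mx -dX.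
pose Z : 'M[int]_n := \matrix_(i, j) ((Y' i j - Y i j) %/ D)%Z.
have ZE : Y' = Y + D *: Z.
  apply/matrixP => i j; rewrite [RHS]mxE [X in _ + X]mxE [Z i j]mxE mulrC divzK; first by rewrite addrC subrK.
  by rewrite -eqz_mod_dvd YX.
(* As X Y = D, the equality Y' = Y + D Z reads Y' = W Y: W is the base change from L to L'. *)
pose W := 1%:M + Z *m X.
have YW : Y' = W *m Y.
  by rewrite /W mulmxDl mul1mx -mulmxA mul_mx_adj mul_mx_scalar.
have DG : (D * D) *: gram L' = (D * D) *: (W *m gram L *m W^T).
  have h (M : 'M[int]_n) (A B : 'M[int]_n) : A *m B = D%:M ->
      A *m (B *m M *m B^T) *m A^T = (D * D) *: M.
    move=> AB; rewrite !mulmxA AB -mulmxA -trmx_mul AB tr_scalar_mx.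
    by rewrite mul_mx_scalar mul_scalar_mx scalerA.
  rewrite -(h _ _ _ YXE') -GX YW.
  have -> : W *m Y *m (X *m gram L *m X^T) *m (W *m Y)^T =
      W *m (Y *m (X *m gram L *m X^T) *m Y^T) *m W^T by rewrite trmx_mul !mulmxA.
  by rewrite (h _ _ _ YXE) -scalemxAr -scalemxAl.
have WG : W *m gram L *m W^T = gram L'.
  by apply/esym/(scalemx_inj (mulf_neq0 dX0 dX0)).
apply: same_genus_unimodular (WG); rewrite unitmxE.
have dG : \det (gram L) = \det (gram L').
  have := congr1 determinant GX; rewrite !det_mulmx !det_tr -dX.
  rewrite [RHS]mulrC [LHS]mulrC => /(mulfI dX0) /(mulfI dX0) //.
have : \det W * \det W = 1.
  apply: (mulIf (gram_det L)); rewrite mul1r [RHS]dG -WG !det_mulmx det_tr; ring.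
by move=> WW; apply/unitrPr; exists (\det W).
Qed.

(** By [same_genus_of_sublattice], det X, the Gram matrix of the rows of X and adj X modulo det X
    determine the genus of L; all their entries are bounded in terms of n and P, so there are
    finitely many codes. *)
Lemma finite_genera (R : realType) n (P : nat) (A : set (set (lattice n))) :
  (forall g, A g -> exists L, g = genus_of R L /\
    exists (p : nat) (X : 'M[int]_n), [/\ (p < P)%N, \det X != 0, positive_definite L &
    forall i, bform L (row i X) (row i X) = p%:Z * p%:Z]) ->
  exists2 s : seq (lattice n), uniq [seq genus_of R L | L <- s] &
    forall g, (g \in [seq genus_of R L | L <- s]) <-> A g.
Proof.
move=> bd.
(* b0 bounds the entries of the Gram matrix of the rows and n! b0^n its determinant. The encoding
   [enc] is used on [-b, b] only, where it is injective. *)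
pose b0 := (P * P)%N; pose b := (n`! * b0 ^ n + b0)%N.
pose enc (x : int) : 'I_(2 * b).+1 := inord `|(x + b%:Z)%R|.
have encI (x y : int) : `|x| <= b%:Z -> `|y| <= b%:Z -> enc x = enc y -> x = y.
  move=> xb yb /(congr1 (@nat_of_ord _)); rewrite !inordK; lia.
pose code (L : lattice n) (X : 'M[int]_n) :=
  (enc (\det X), map_mx enc (X *m gram L *m X^T), map_mx (fun a => enc (a %% \det X)%Z) (\adj X)).
pose Q (c : 'I_(2 * b).+1 * 'M_n * 'M_n) (g : set (lattice n)) := A g /\
  exists L, g = genus_of R L /\
    exists (p : nat) (X : 'M[int]_n), [/\ (p < P)%N, \det X != 0, positive_definite L &
    forall i, bform L (row i X) (row i X) = p%:Z * p%:Z] /\ code L X = c.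
have code_bound (L : lattice n) (X : 'M[int]_n) (p : nat) : (p < P)%N -> \det X != 0 ->
    positive_definite L -> (forall i, bform L (row i X) (row i X) = p%:Z * p%:Z) ->
    `|\det X| <= b%:Z /\ forall i j, `|(X *m gram L *m X^T) i j| <= b%:Z.
  move=> pP dX Lp XN.
  have GX_b i j : `|(X *m gram L *m X^T) i j| <= b0%:Z.
    rewrite gramE; apply: (@le_trans _ _ (p%:Z * p%:Z)).
      by apply: (bform_norm_le Lp); apply: XN.
    by rewrite -PoszM lez_nat leq_mul // ltnW.
  split; last first.
    by move=> i j; rewrite (le_trans (GX_b i j)) // lez_nat /b leq_addl.
  (* This determinant is (det X)^2 det L, with nonzero integer factors. *)
  apply: (@le_trans _ _ `|\det (X *m gram L *m X^T)|).
    rewrite !det_mulmx det_tr !normrM -mulrA.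
    rewrite ler_peMr ?normr_ge0 // -normrM.
    by rewrite -gtz0_ge1 normr_gt0 mulf_neq0 ?gram_det.
  rewrite (le_trans (norm_det_le GX_b)) // /b PoszD PoszM natz.
  rewrite -[b0%:Z]natz -natrX natz. 
  by rewrite lerDl.
have Quniq c g g' : Q c g -> Q c g' -> g = g'.
  move=> [_ [L [-> [p [X [[pP dX Lp XN] <-]]]]]].
  move=> [_ [L' [-> [p' [X' [[pP' dX' Lp' XN'] [eD eG eY]]]]]]].
  have [D_b GX_b] := code_bound L X p pP dX Lp XN.
  have [D_b' GX_b'] := code_bound L' X' p' pP' dX' Lp' XN'.
  have DD : \det X = \det X' by apply: encI.
  have mod_b (a : int) : `|(a %% \det X)%Z| <= b%:Z.
    by rewrite ger0_norm ?modz_ge0 // ltW // (lt_le_trans (ltz_mod a dX)).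
  suff gLL' : same_genus R L L'.
    apply/seteqP; split => M; first exact: same_genus_trans (same_genus_sym gLL').
    exact: same_genus_trans.
  apply: (@same_genus_of_sublattice R n L L' X X') => //.
    apply/matrixP => i j; apply: encI; rewrite ?GX_b ?GX_b' //.
    by move/matrixP: eG => /(_ i j); rewrite !mxE.
  move=> i j; apply: encI => //.
  by move/matrixP: eY => /(_ i j); rewrite -DD [LHS]mxE [RHS]mxE.
have Qex g : A g -> exists c, Q c g.
  move=> Ag; have [L [gL [p [X h]]]] := bd g Ag.
  by exists (code L X); split => //; exists L; split => //; exists p, X.
(* A code that comes from no genus gets the empty set as default value; the filter below keeps only
   members of A. *)
pose rep c := xget (classical_sets.set0 : set (lattice n)) (Q c : set (set (lattice n))).
pose gs := undup [seq g <- [seq rep c | c <- enum {: 'I_(2 * b).+1 * 'M_n * 'M_n}] | `[< A g >]].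
have gsE g : g \in gs <-> A g.
  rewrite mem_undup mem_filter; split; first by move=> /andP [/asboolP].
  move=> Ag; apply/andP; split; first exact/asboolP.
  have [c Qc] := Qex g Ag; apply/mapP; exists c; first by rewrite mem_enum.
  by apply: (Quniq c) => //; rewrite /rep; apply: xgetPex; exists g.
have [s sE] : exists s : seq (lattice n), [seq genus_of R L | L <- s] = gs.
  have : {in gs, forall g, exists L, g = genus_of R L}.
    by move=> g /gsE /bd [L [gL _]]; exists L.
  elim: gs {gsE} => [|g gs IH] h; first by exists [::].
  have [L gL] := h g (mem_head _ _).
  have [|s sE] := IH; first by move=> x xs; apply: h; rewrite inE xs orbT.
  by exists (L :: s); rewrite /= sE gL.
by exists s; rewrite sE ?undup_uniq.
Qed.

(** * The table of idoneal genera *)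

Theorem theorem2p25 (R : realType) :
  exists P : murec 1, forall n : nat, (3 <= n)%N ->
    exists s : seq (lattice n),
      [/\ computes P [tuple n] (code_lattices s),
          uniq [seq genus_of R L | L <- s] &
          forall g : set (lattice n),
            (g \in [seq genus_of R L | L <- s]) <-> idoneal R g].
Proof.
have [P [N bounds]] := unit_vector_genus_bounds.
have idonealP n (g : set (lattice n)) : (3 <= n)%N -> idoneal R g ->
    (n < N)%N /\ exists L, g = genus_of R L /\
    exists (p : nat) (X : 'M[int]_n), [/\ (p < P)%N, \det X != 0, positive_definite L &
    forall i, bform L (row i X) (row i X) = p%:Z * p%:Z].
  move=> n3 [[L ->] gp gu]; have Lp : positive_definite L.
    by apply: gp; apply: same_genus_refl.
  have [nN [p [X [pP dX XN]]]] := bounds R n L n3 Lp gu.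
  by split => //; exists L; split => //; exists p, X.
(* The lists are chosen by [cid], so the table is shown to exist without being exhibited; below rank
   3 the list is empty by convention. *)
have h n : {s : seq (lattice n) | (3 <= n)%N -> uniq [seq genus_of R L | L <- s] /\
    forall g : set (lattice n), (g \in [seq genus_of R L | L <- s]) <-> idoneal R g}.
  apply: cid; have [n3|n3] := leqP 3 n; last by exists [::].
  have [s us sE] := @finite_genera R n P (idoneal R (n := n)) (fun g Ag => proj2 (idonealP n g n3 Ag)).
  by exists s.
(* From rank [maxn N 3] on the list is empty, and the empty list has code 0. *)
have [|Q QE] := @eventually_zero_computable (maxn N 3) (fun n => code_lattices (sval (h n))).
  move=> n; rewrite geq_max => /andP [Nn n3].
  have [_] := svalP (h n) n3; case: (sval (h n)) => [|L s] //= sE.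
  have /idonealP [//|] : idoneal R (genus_of R L) by apply/sE; rewrite mem_head.
  by rewrite ltnNge Nn.
by exists Q => n n3; exists (sval (h n)); have [us sE] := svalP (h n) n3.
Qed.
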